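(* Consider the fixed capacity scenario with $0<C_M<\bar C$. Under the ISP's optimal service differentiation, users with values lower than the marginal user value $\hat\theta$ will not use any network service (i.e. $q^*(\theta)=1$ for $\theta<\hat\theta$). In particular, the marginal user value $\hat\theta$ satisfies: (a) if $h(1)=0$, then $\hat\theta$ is the unique solution of the equation $G(\hat\theta)=\hat\theta-\frac{1-F(\hat\theta)}{f(\hat\theta)}=0$, i.e. $\hat\theta=\theta_0$; (b) if $h(1)>0$, then $\hat\theta$ depends on both the user distribution $F$ and the fixed capacity $C_M$: given any $F$, $\hat\theta$ decreases in $C_M$, with the asymptotic limit $\lim_{C_M\to\bar C}\hat\theta=\theta_0$.
   Context: Users have types $\theta\in[0,1]$ distributed with density $f$ (continuously differentiable and strictly positive on $[0,1]$) and CDF $F$. The function $v:[0,1]\to\mathbb{R}_+$ is continuously differentiable and strictly decreasing with $v(0)=1$, $v(1)=0$. The function $w:[0,1]\to\mathbb{R}_+$ is continuously differentiable and decreasing with $w(1)=0$ (the case $w(0)=+\infty$ is also allowed, $w$ then being continuously differentiable on $(0,1]$). A strategy (service differentiation) of the ISP is a pair $(\mathcal{Q},p)$, where $\mathcal{Q}\subseteq[0,1]$ is the set of offered congestion levels and $p:\mathcal{Q}\to\mathbb{R}_+$ gives prices; users may always choose the dummy class $q=1$ with $p(1)=0$ (opting out, i.e. using no service). The user choice function satisfies $q(\theta)\in\arg\max_{q\in\mathcal{Q}}\theta v(q)-p(q)$. The ISP maximizes $\int_0^1p(q(\theta))f(\theta)\,\mathrm{d}\theta$ subject to $\int_0^1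 w(q(\theta))f(\theta)\,\mathrm{d}\theta\le C_M$ (fixed capacity scenario). Assumptions: the virtual valuation $G(\theta)\triangleq\theta-\frac{1-F(\theta)}{f(\theta)}$ has a unique zero $\theta_0$ in $(0,1)$ and is strictly increasing on $(\theta_0,1)$; $G^{-1}$ denotes the inverse of $G$ restricted to $[\theta_0,1]$. The virtual capacity $h(q)\triangleq w'(q)/v'(q)$ (with $v'\ne0$ on $(0,1)$) is strictly decreasing on $(0,1)$, with one-sided limits $h(0)\in(0,+\infty]$, $h(1)\in[0,+\infty)$; $h^{-1}$ on $[h(1),+\infty)$ is the inverse of $h$ on $[h(1),h(0)]$ and $0$ on $(h(0),+\infty)$. Put $\bar C\triangleq[1-F(\theta_0)]w(0)$. For $0<C_M<\bar C$ the optimal user choice function $q^*$, marginal user $\hat\theta$ and shadow price $\mu>0$ are the unique solution of: $q^*(\theta)=1$ for $\theta\in[0,\hat\theta)$, $q^*(\theta)=h^{-1}(G(\theta)/\mu)$ for $\theta\in[\hat\theta,1]$; $\hat\theta=G^{-1}(\mu h(1))$; $\int_0^1w(q^*(\theta))f(\theta)\,\mathrm{d}\theta=C_M$. *)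

(* Defs.v *)
From HB Require Import structures.
From mathcomp Require Import all_boot all_order all_algebra.
From mathcomp Require Import all_classical all_reals all_analysis.

Set Implicit Arguments.
Unset Strict Implicit.
Unset Printing Implicit Defensive.

Import Order.TTheory GRing.Theory Num.Theory.
Import numFieldNormedType.Exports.

Local Open Scope classical_set_scope.
Local Open Scope ring_scope.

(* All functions of types and congestion levels are total on R; only their
   values on [0, 1] are constrained or used. *)
Section Model.
Context {R : realType}.
Implicit Types (f v : R -> R) (w : R -> \bar R) (q p : R -> R).

(* Derivatives are taken relative to A, hence one-sided at endpoints lying
   in A. *)
Definition continuously_differentiable_on (A : set R) (g : R -> R) : Prop :=
  exists g' : R -> R,
    {within A, continuous g'} /\
    forall x : R, A x ->
      (g y - g x) / (y - x) @[y --> within A (x^')] --> g' x.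

Definition cdf f (x : R) : R :=
  \int[lebesgue_measure]_(t in `[0, x]) f t.

Definition virtual_valuation f (x : R) : R := x - (1 - cdf f x) / f x.

Record user_density f (theta0 : R) : Prop := {
  density_C1 : continuously_differentiable_on `[0, 1] f;
  density_gt0 : forall x : R, x \in `[0, 1] -> 0 < f x;
  density_total :
    (\int[lebesgue_measure]_(t in `[0%R, 1%R]) (f t)%:E = 1)%E;
  virtual_valuation_in : theta0 \in `]0, 1[;
  virtual_valuation_zero : virtual_valuation f theta0 = 0;
  virtual_valuation_uniq : forall x : R, x \in `]0, 1[ ->
    virtual_valuation f x = 0 -> x = theta0;
  virtual_valuation_incr : forall x y : R, x \in `]theta0, 1[ ->
    y \in `]theta0, 1[ -> x < y ->
    virtual_valuation f x < virtual_valuation f y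
}.

Record utility_function v : Prop := {
  utility_C1 : continuously_differentiable_on `[0, 1] v;
  utility_decr : forall x y : R, x \in `[0, 1] -> y \in `[0, 1] ->
    x < y -> v y < v x;
  utility_0 : v 0 = 1;
  utility_1 : v 1 = 0
}.

(* w 0 = +oo is allowed; it is then the limit of w at 0. *)
Record capacity_function w : Prop := {
  capacity_ge0 : forall x : R, x \in `[0, 1] -> (0 <= w x)%E;
  capacity_decr : forall x y : R, x \in `[0, 1] -> y \in `[0, 1] ->
    x <= y -> (w y <= w x)%E;
  capacity_1 : w 1 = 0%E;
  capacity_fin : forall x : R, x \in `]0, 1] -> w x \is a fin_num;
  capacity_C1 :
    (w 0 \is a fin_num /\
       continuously_differentiable_on `[0, 1] (fine \o w)) \/
    [/\ w 0 = +oo%E,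
        continuously_differentiable_on `]0, 1] (fine \o w) &
        w x @[x --> 0^'+] --> +oo%E]
}.

Definition virtual_capacity v w (x : R) : R :=
  derive1 (fine \o w) x / derive1 v x.

Record regular_virtual_capacity v w (h0 : \bar R) (h1 : R) : Prop := {
  utility_derive_neq0 : forall x : R, x \in `]0, 1[ -> derive1 v x != 0;
  virtual_capacity_decr : forall x y : R, x \in `]0, 1[ -> y \in `]0, 1[ ->
    x < y -> virtual_capacity v w y < virtual_capacity v w x;
  virtual_capacity_0 : (virtual_capacity v w x)%:E @[x --> 0^'+] --> h0;
  virtual_capacity_1 : virtual_capacity v w x @[x --> 1^'-] --> h1;
  virtual_capacity_0_gt0 : (0 < h0)%E;
  virtual_capacity_1_ge0 : 0 <= h1
}.

Definition virtual_capacity_ext v w (h0 : \bar R) (h1 : R) (x : R) : \bar R :=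
  if x == 0 then h0 else if x == 1 then h1%:E else (virtual_capacity v w x)%:E.

(* The graph of the inverse of h, as a relation "x = h^-1(y)"; it has no
   point for y < h1. *)
Definition virtual_capacity_inv v w (h0 : \bar R) (h1 y x : R) : Prop :=
  if (h0 < y%:E)%E then x = 0
  else x \in `[0, 1] /\ virtual_capacity_ext v w h0 h1 x = y%:E.

Definition max_capacity f w (theta0 : R) : \bar R :=
  ((1 - cdf f theta0)%:E * w 0%R)%E.

Definition strategy (Q : set R) p : Prop :=
  [/\ Q `<=` `[0, 1], forall x : R, Q x -> 0 <= p x & p 1 = 0].

(* Users choose among the offered classes and the dummy class 1. *)
Definition user_choice v (Q : set R) p q : Prop :=
  forall t : R, t \in `[0, 1] ->
    (1 |` Q) (q t) /\
    forall x : R, (1 |` Q) x -> t * v x - p x <= t * v (q t) - p (q t).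

Definition capacity_usage f w q : \bar R :=
  (\int[lebesgue_measure]_(t in `[0%R, 1%R]) (w (q t) * (f t)%:E))%E.

Definition revenue f p q : \bar R :=
  (\int[lebesgue_measure]_(t in `[0%R, 1%R]) (p (q t) * f t)%:E)%E.

Definition feasible f v w (C : R) (Q : set R) p q : Prop :=
  [/\ strategy Q p, user_choice v Q p q & (capacity_usage f w q <= C%:E)%E].

Definition isp_optimal f v w (C : R) (Q : set R) p q : Prop :=
  feasible f v w C Q p q /\
  forall Q' p' q', feasible f v w C Q' p' q' ->
    (revenue f p' q' <= revenue f p q)%E.

(* The system determining the optimal choice function q, marginal user
   value that and shadow price mu. The fields marginal_user_in and
   marginal_user_eq together say that that = G^-1(mu * h1), for G
   restricted to [theta0, 1]. *)
Record optimality_system f v w (theta0 : R) (h0 : \bar R) (h1 C : R)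
    q (that mu : R) : Prop := {
  shadow_price_gt0 : 0 < mu;
  marginal_user_in : that \in `[theta0, 1];
  marginal_user_eq : virtual_valuation f that = mu * h1;
  choice_below : forall t : R, t \in `[0, that[ -> q t = 1;
  choice_above : forall t : R, t \in `[that, 1] ->
    virtual_capacity_inv v w h0 h1 (virtual_valuation f t / mu) (q t);
  capacity_binding : capacity_usage f w q = C%:E
}.

End Model.

(* Main.v *)
(* The payoff of type t has subgradient v (q t) (envelope), so integrating by parts
   the revenue of any implementable choice q is the integral of G f v (q).
   Pointwise, q* t maximizes the Lagrangian G t v - mu w, whose derivative in the
   congestion level is v' (G t - mu h); below the marginal type G < mu h(1), so the
   class 1 is the strict maximizer, and the Lagrangian loss of serving a range of
   types below it contradicts optimality.
   Monotonicity in C: a smaller shadow price only lowers q*, hence raises the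
   usage.  Limit: if the marginal type stayed above some a > theta0, the usage would
   stay away from its upper bound.
   Dependence on F: taking mass from types far below theta0 and spreading it over
   the rest in proportion to f multiplies f and 1 - F by 1 + eps above theta0, which
   keeps G there; the new market with capacity C is then solved by the old solution
   for C / (1 + eps). *)
Require Import Defs.
From HB Require Import structures.
From mathcomp Require Import all_boot all_order all_algebra.
From mathcomp Require Import all_classical all_reals all_analysis.
From mathcomp Require Import measurable_realfun ring lra.

Set Implicit Arguments.
Unset Strict Implicit.
Unset Printing Implicit Defensive.

Import Order.TTheory GRing.Theory Num.Theory.
Import numFieldNormedType.Exports.

Local Open Scope classical_set_scope.
Local Open Scope ring_scope.

(* [probability] also exports a [cdf]. *)
Local Notation cdf := Defs.cdf.


(** That q* is optimal is not among the hypotheses, so q* enters as a competitor: prices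
    implementing it are constructed, and weak duality compares its revenue with that of any feasible
    choice. A deviation at one type has measure zero; choices being nonincreasing, it spreads to an
    interval of types. Choices may jump, so their utility need not be differentiable everywhere and
    the integration by parts cannot proceed pointwise. Instead the error over [s, t] is bounded by t
    - s times the increment of a fixed function, and such errors vanish under subdivision. If w is
    infinite at 0, a rival choice may have infinite usage at some types, so the duality inequality
    is integrated in the extended reals, after a shift making all integrands nonnegative. Solutions
    of the optimality system are given for the original density only. The second market must
    therefore inherit one of them, which is why the change of density has to preserve G above theta0
    exactly and not just approximately. *)

(** * Integration of bounded measurable functions over [0, 1] *)

Section UnitInterval.
Context {R : realType}.
Implicit Types (g : R -> R) (s t x y : R).
Local Notation leb := (@lebesgue_measure R).

(** This class is closed under ring operations, contains monotone and continuous functions, and lies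
    in L1 of every subinterval of [0, 1], so it settles all integrability conditions below. *)
Definition bounded_measurable g : Prop :=
  measurable_fun (`[0, 1]%classic : set R) g /\
  exists M, forall x, x \in `[0, 1] -> `|g x| <= M.

Definition primitive g t : R := \int[leb]_(x in `[0, t]) g x.

Lemma bounded_measurable_cst (c : R) : bounded_measurable (fun=> c).
Proof. by split; [exact: measurable_cst | exists `|c|]. Qed.

Lemma bounded_measurable_add g1 g2 : bounded_measurable g1 ->
  bounded_measurable g2 -> bounded_measurable (fun x => g1 x + g2 x).
Proof.
move=> [m1 [M1 b1]] [m2 [M2 b2]]; split; first exact: measurable_funD.
exists (M1 + M2) => x x01.
by rewrite (le_trans (ler_normD _ _))// lerD ?b1 ?b2.
Qed.

Lemma bounded_measurable_mul g1 g2 : bounded_measurable g1 ->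
  bounded_measurable g2 -> bounded_measurable (fun x => g1 x * g2 x).
Proof.
move=> [m1 [M1 b1]] [m2 [M2 b2]]; split; first exact: measurable_funM.
by exists (M1 * M2) => x x01; rewrite normrM ler_pM ?b1 ?b2.
Qed.

Lemma bounded_measurable_opp g : bounded_measurable g ->
  bounded_measurable (fun x => - g x).
Proof.
move=> [m1 [M1 b1]]; split; first exact: measurableT_comp.
by exists M1 => x x01; rewrite normrN b1.
Qed.

Lemma bounded_measurable_sub g1 g2 : bounded_measurable g1 ->
  bounded_measurable g2 -> bounded_measurable (fun x => g1 x - g2 x).
Proof.
by move=> b1 b2; apply: bounded_measurable_add => //; exact: bounded_measurable_opp.
Qed.

Lemma bounded_measurable_eq g1 g2 : {in `[0, 1], g1 =1 g2} ->
  bounded_measurable g1 -> bounded_measurable g2.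
Proof.
move=> e [m1 [M b]]; split; last by exists M => x x01; rewrite -e ?b.
by apply: eq_measurable_fun m1 => x; rewrite inE; exact: e.
Qed.

Lemma bounded_measurable_monotone g :
  {in `[0, 1] &, {homo g : x y / x <= y}} -> bounded_measurable g.
Proof.
move=> mg; have i0 : 0 \in `[0, 1 : R] by rewrite in_itv/= lexx ler01.
have i1 : 1 \in `[0, 1 : R] by rewrite in_itv/= lexx ler01.
split; last first.
  exists (`|g 0| + `|g 1|) => x x01.
  have g0 : g 0 <= g x by apply: mg => //; rewrite (itvP x01).
  have g1 : g x <= g 1 by apply: mg => //; rewrite (itvP x01).
  have := ler_norm (g 1); have := ler_norm (- g 0); rewrite normrN => n0 n1.
  have p0 := normr_ge0 (g 0); have p1 := normr_ge0 (g 1).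
  by rewrite ler_norml; apply/andP; split; lra.
(* Precomposing with the clamp makes g monotone on the whole line without changing it on [0, 1]. *)
pose clamp x := Num.max 0 (Num.min x 1) : R.
have cl x : clamp x \in `[0, 1].
  by rewrite in_itv/= /clamp le_max lexx/= ge_max ler01 ge_min lexx orbT.
apply: (@eq_measurable_fun _ _ _ _ _ (g \o clamp)).
  move=> x; rewrite inE/= in_itv/= => /andP[x0 x1]; rewrite /clamp.
  by rewrite (min_idPl x1) (max_idPr x0).
apply: nondecreasing_measurable => // x y xy; apply: mg => //.
by rewrite /clamp le_max2// le_min2.
Qed.

Lemma bounded_measurable_continuous g :
  {within `[0, 1], continuous g} -> bounded_measurable g.
Proof.
move=> cg; split; first exact: subspace_continuous_measurable_fun.
have [c _ hc] := EVT_max ler01 cg; have [d _ hd] := EVT_min ler01 cg.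
exists (`|g c| + `|g d|) => x x01.
have := hc x x01; have := hd x x01.
have := ler_norm (g c); have := ler_norm (- g d); rewrite normrN => n0 n1.
have p0 := normr_ge0 (g c); have p1 := normr_ge0 (g d).
by move=> ? ?; rewrite ler_norml; apply/andP; split; lra.
Qed.

Lemma subset_unit (i : interval R) : (i <= `[0, 1]%R)%O ->
  [set` i] `<=` [set` `[0, 1 : R]%R].
Proof. by move=> h x; apply: subitvP. Qed.

Lemma bounded_measurable_integrable g (i : interval R) : (i <= `[0, 1]%R)%O ->
  bounded_measurable g -> leb.-integrable [set` i] (EFin \o g).
Proof.
move=> /subset_unit i01 [mg [M b]].
apply: (@integrableS _ _ _ leb (`[0, 1]%classic : set R)) => //.
apply: measurable_bounded_integrable => //.
- by rewrite /= lebesgue_measure_itv/= lte_fin ltr01 -EFinB ltry.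
- by exists M; split; [exact: num_real|] => N MN x x01;
    apply: (le_trans (b x x01)); exact: ltW.
Qed.

Lemma primitive_sub g s t : 0 <= s -> s <= t -> t <= 1 -> bounded_measurable g ->
  primitive g t - primitive g s = \int[leb]_(x in `]s, t]) g x.
Proof.
move=> s0 st t1 bg; rewrite /primitive Rintegral_itvB ?bnd_simp//.
by apply: bounded_measurable_integrable => //; rewrite subitvE !bnd_simp.
Qed.

Lemma le_primitive_sub g1 g2 s t : 0 <= s -> s <= t -> t <= 1 ->
  bounded_measurable g1 -> bounded_measurable g2 ->
  (forall x, s < x <= t -> g1 x <= g2 x) ->
  primitive g1 t - primitive g1 s <= primitive g2 t - primitive g2 s.
Proof.
move=> s0 st t1 b1 b2 h; rewrite !primitive_sub//; apply: le_Rintegral => //.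
- by apply: bounded_measurable_integrable => //; rewrite subitvE !bnd_simp s0.
- by apply: bounded_measurable_integrable => //; rewrite subitvE !bnd_simp s0.
Qed.

Lemma primitive0 g : primitive g 0 = 0.
Proof. by rewrite /primitive set_itv1 Rintegral_set1. Qed.

Lemma le_primitive g1 g2 t : 0 <= t -> t <= 1 ->
  bounded_measurable g1 -> bounded_measurable g2 ->
  (forall x, x \in `[0, t] -> g1 x <= g2 x) -> primitive g1 t <= primitive g2 t.
Proof.
move=> t0 t1 b1 b2 h; have := @le_primitive_sub g1 g2 0 t (lexx 0) t0 t1 b1 b2.
rewrite !primitive0 !subr0; apply => x /andP[x0 xt].
by apply: h; rewrite in_itv/= ltW.
Qed.

Lemma eq_primitive g1 g2 t : {in `[0, t], g1 =1 g2} ->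
  primitive g1 t = primitive g2 t.
Proof. by move=> e; apply: eq_Rintegral => x; rewrite inE; exact: e. Qed.

Lemma primitiveD g1 g2 t : 0 <= t -> t <= 1 ->
  bounded_measurable g1 -> bounded_measurable g2 ->
  primitive (fun x => g1 x + g2 x) t = primitive g1 t + primitive g2 t.
Proof.
by move=> t0 t1 b1 b2; apply: RintegralD => //;
  apply: bounded_measurable_integrable => //; rewrite subitvE !bnd_simp.
Qed.

Lemma primitiveB g1 g2 t : 0 <= t -> t <= 1 ->
  bounded_measurable g1 -> bounded_measurable g2 ->
  primitive (fun x => g1 x - g2 x) t = primitive g1 t - primitive g2 t.
Proof.
by move=> t0 t1 b1 b2; apply: RintegralB => //;
  apply: bounded_measurable_integrable => //; rewrite subitvE !bnd_simp.
Qed.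

Lemma primitiveZ g (c : R) t : 0 <= t -> t <= 1 -> bounded_measurable g ->
  primitive (fun x => c * g x) t = c * primitive g t.
Proof.
by move=> t0 t1 b1; apply: RintegralZl => //;
  apply: bounded_measurable_integrable => //; rewrite subitvE !bnd_simp.
Qed.

Lemma primitive_cst (c : R) t : 0 <= t -> primitive (fun=> c) t = c * t.
Proof.
move=> t0; rewrite /primitive Rintegral_cst//= lebesgue_measure_itv/= lte_fin.
by case: ltP => [_|t0']; rewrite ?oppr0 ?addr0//=; congr (_ * _); lra.
Qed.

Lemma EFin_primitive g : bounded_measurable g ->
  (\int[leb]_(x in `[0%R, 1%R]) (g x)%:E = (primitive g 1)%:E)%E.
Proof.
move=> bg; rewrite /primitive /Rintegral fineK//; apply: integrable_fin_num => //.
exact: bounded_measurable_integrable.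
Qed.

Lemma primitive_sub_bounds g s t (m M : R) : 0 <= s -> s <= t -> t <= 1 ->
  bounded_measurable g -> (forall x, s < x <= t -> m <= g x <= M) ->
  m * (t - s) <= primitive g t - primitive g s <= M * (t - s).
Proof.
move=> s0 st t1 bg h; have t0 := le_trans s0 st.
have bc c := bounded_measurable_cst c.
have e c : c * (t - s) = primitive (fun=> c) t - primitive (fun=> c) s.
  by rewrite !primitive_cst// mulrBr.
by rewrite !e; apply/andP; split; apply: le_primitive_sub => // x /h /andP[].
Qed.

Lemma primitive_continuous g : bounded_measurable g ->
  {within `[0, 1], continuous (primitive g)}.
Proof.
move=> bg; apply: parameterized_integral_continuous; first exact: ler01.
exact: bounded_measurable_integrable.
Qed.

(* Summing over the uniform subdivision of [0, 1] into n pieces bounds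
   |D 1 - D 0| by (k 1 - k 0) / n. *)
Lemma eq_of_small_increments (D k : R -> R) :
  (forall s t, 0 <= s -> s <= t -> t <= 1 ->
    `|D t - D s| <= (t - s) * (k t - k s)) -> D 1 = D 0.
Proof.
move=> h; apply/eqP; rewrite -subr_eq0 -normr_le0.
apply/ler_addgt0Pr => e e0; rewrite add0r.
have k01 : 0 <= k 1 - k 0.
  have := h 0 1 (lexx 0) ler01 (lexx 1); rewrite subr0 mul1r.
  exact: le_trans.
(* Chosen larger than [(k 1 - k 0) / e], so that the accumulated error is at most e. *)
pose n := (Num.truncn ((k 1 - k 0) / e)).+1.
have n0 : 0 < n%:R :> R by rewrite ltr0n.
have step i : (i <= n)%N ->
    `|D (i%:R / n%:R) - D 0| <= n%:R^-1 * (k (i%:R / n%:R) - k 0).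
  elim: i => [|i IH] ile; first by rewrite mul0r !subrr normr0 mulr0.
  have := h (i%:R / n%:R) (i.+1%:R / n%:R).
  rewrite divr_ge0 ?ler0n// ler_pM2r ?invr_gt0// ler_nat leqnSn.
  rewrite ler_pdivrMr// mul1r ler_nat ile => /(_ erefl erefl erefl).
  rewrite -mulrBl -natrB// subSnn mul1r => h1.
  have := IH (ltnW ile) => h2.
  rewrite -(subrKA (D (i%:R / n%:R))) (le_trans (ler_normD _ _))//.
  by rewrite (le_trans (lerD h1 h2))// -mulrDr subrKA.
have := step n (leqnn n); rewrite divff ?gt_eqF// => /le_trans; apply.
rewrite mulrC ler_pdivrMr// mulrC -ler_pdivrMr// ltW// truncnS_gt//.
Qed.

End UnitInterval.

(** * From difference quotients relative to a set to continuity and derivatives *)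

Section Calculus.
Context {R : realType}.
Implicit Types (A : set R) (g : R -> R).

(** Near x the quotient is within 1 of [g' x], which gives a Lipschitz estimate at x with constant
    [|g' x| + 1]. *)
Lemma continuously_differentiable_continuous A g :
  continuously_differentiable_on A g -> {within A, continuous g}.
Proof.
move=> [g' [_ dg]]; apply/subspace_continuousP => x Ax.
apply/cvgrPdist_lt => e e0.
have c0 : 0 < `|g' x| + 1 by rewrite ltr_wpDl.
have /cvgrPdist_lt/(_ _ ltr01) q1 := dg x Ax.
have q2 : \forall y \near x, `|x - y| < e / (`|g' x| + 1).
  exact: nbhsx_ballx x _ (divr_gt0 e0 c0).
rewrite near_withinE in q1; rewrite near_withinE.
have {}q1 : \forall y \near x, y != x -> A y ->
    `|g' x - (g y - g x) / (y - x)| < 1.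
  by move: q1; rewrite /dnbhs near_withinE.
apply: (filterS2 _ _ q1 q2) => y {}q1 {}q2 Ay.
have [->|yx] := eqVneq y x; first by rewrite subrr normr0.
have yx0 : y - x != 0 by rewrite subr_eq0.
have {}q1 := q1 yx Ay.
rewrite distrC -[g y - g x](divfK yx0) normrM [`|y - x|]distrC.
have q3 : `|(g y - g x) / (y - x)| < `|g' x| + 1.
  have := ler_distD 0 (g' x) ((g y - g x) / (y - x)).
  by have := lerB_dist ((g y - g x) / (y - x)) (g' x); rewrite distrC; lra.
move: q2; rewrite ltr_pdivlMr// => q2; apply: le_lt_trans q2.
by rewrite mulrC ler_wpM2l ?normr_ge0// ltW.
Qed.

(** At an interior point the restriction to A is eventually void, and [y = h + x] turns the quotient
    into the one defining the derivative. *)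
Lemma continuously_differentiable_derivable A g x : nbhs x A ->
  continuously_differentiable_on A g -> derivable g x 1.
Proof.
move=> nA [g' [_ dg]]; have Ax : A x := nbhs_singleton nA.
have {dg} : (g y - g x) / (y - x) @[y --> x^'] --> g' x.
  move=> V /(dg x Ax) h.
  have {}h : \forall y \near x^', A y -> V ((g y - g x) / (y - x)) by exact: h.
  have nA' : \forall y \near x^', A y by exact: nbhs_dnbhs.
  by apply: (filterS2 _ _ h nA') => y; apply.
move=> cg; apply/cvg_ex; exists (g' x).
have /cvgrPdist_lt cg' := cg.
apply/cvgrPdist_lt => e /cg'.
rewrite !/dnbhs !near_withinE !nearE => /nbhs_ballP[d /= d0 hd].
apply/nbhs_ballP; exists d => //= h hh h0.
have /= := hd (h + x); rewrite addrK /GRing.scale/= mulr1 [h^-1 * _]mulrC.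
apply; last by rewrite -subr_eq0 addrK.
by move: hh; rewrite /ball/= sub0r normrN opprD addrCA subrr addr0 normrN.
Qed.

Lemma derivable_derive1 g x : derivable g x 1 -> is_derive x 1 g (derive1 g x).
Proof. by move=> dg; apply: DeriveDef => //; rewrite derive1E. Qed.

End Calculus.

(** * Continuity relative to a set, and monotonicity up to the endpoints *)

Section Continuity.
Context {R : realType}.
Implicit Types (g : R -> R) (A : set R).

Lemma within_continuousD A g1 g2 : {within A, continuous g1} ->
  {within A, continuous g2} -> {within A, continuous (fun x => g1 x + g2 x)}.
Proof. by move=> c1 c2 x; apply: cvgD; [exact: c1|exact: c2]. Qed.

Lemma within_continuousM A g1 g2 : {within A, continuous g1} ->
  {within A, continuous g2} -> {within A, continuous (fun x => g1 x * g2 x)}.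
Proof. by move=> c1 c2 x; apply: cvgM; [exact: c1|exact: c2]. Qed.

Lemma within_continuousN A g : {within A, continuous g} ->
  {within A, continuous (fun x => - g x)}.
Proof. by move=> c x; apply: cvgN; exact: c. Qed.

Lemma within_continuousV A g : {within A, continuous g} ->
  (forall x, A x -> g x != 0) -> {within A, continuous (fun x => (g x)^-1)}.
Proof.
move=> /subspace_continuousP c g0; apply/subspace_continuousP => x Ax.
by apply: cvgV; [exact: g0|exact: c].
Qed.

Lemma within_continuous_id A : {within A, continuous (fun x : R => x)}.
Proof. by apply: continuous_subspaceT => x; exact: cvg_id. Qed.

Lemma within_continuous_cst A (c : R) : {within A, continuous (fun=> c)}.
Proof. by apply: continuous_subspaceT => x; exact: cvg_cst. Qed.

(** Limits preserve only weak inequalities, so strictness is taken between the two interior points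
    that cut [x, y] into thirds. *)
Lemma incr_itv_closure g (a b : R) : a < b -> {within `[a, b], continuous g} ->
  {in `]a, b[ &, {homo g : x y / x < y}} ->
  {in `[a, b] &, {homo g : x y / x < y}}.
Proof.
move=> ab /(continuous_within_itvP _ ab)[_ ga gb] gi x y.
rewrite !in_itv/= => /andP[ax _] /andP[_ yb] xy.
pose u := (x + x + y) / 3; pose w := (x + y + y) / 3.
have xu : x < u by rewrite /u; lra.
have uw : u < w by rewrite /u /w; lra.
have wy : w < y by rewrite /w; lra.
have uab : u \in `]a, b[ by rewrite in_itv/=; apply/andP; split; lra.
have wab : w \in `]a, b[ by rewrite in_itv/=; apply/andP; split; lra.
have gx : g x <= g u.
  move: ax; rewrite le_eqVlt => /predU1P[ax|ax]; last first.
    by apply/ltW/gi => //; rewrite in_itv/=; apply/andP; split; lra.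
  rewrite -ax; apply: (cvgr_to_le ga); near=> z; apply/ltW/gi => //; last first.
    by near: z; apply: nbhs_right_lt; lra.
  rewrite in_itv/=; apply/andP; split; first by near: z; exact: nbhs_right_gt.
  by near: z; apply: nbhs_right_lt; lra.
have gy : g w <= g y.
  move: yb; rewrite le_eqVlt => /predU1P[yb|yb]; last first.
    by apply/ltW/gi => //; rewrite in_itv/=; apply/andP; split; lra.
  rewrite yb; apply: (cvgr_to_ge gb); near=> z; apply/ltW/gi => //; last first.
    by near: z; apply: nbhs_left_gt; lra.
  rewrite in_itv/=; apply/andP; split; last by near: z; exact: nbhs_left_lt.
  by near: z; apply: nbhs_left_gt; lra.
exact: le_lt_trans gx (lt_le_trans (gi _ _ uab wab uw) gy).
Unshelve. all: by end_near. Qed.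

End Continuity.

(** * The distribution of types and the sign and monotonicity of G *)

Section Density.
Context {R : realType} {f : R -> R} {theta0 : R}.
Hypothesis hf : user_density f theta0.
Implicit Types s t : R.

Lemma density_continuous : {within `[0, 1], continuous f}.
Proof. exact: continuously_differentiable_continuous (density_C1 hf). Qed.

Lemma bounded_measurable_density : bounded_measurable f.
Proof. exact: bounded_measurable_continuous density_continuous. Qed.

Lemma cdf0 : cdf f 0 = 0.
Proof. exact: primitive0. Qed.

Lemma cdf1 : cdf f 1 = 1.
Proof.
apply/EFin_inj; rewrite -(density_total hf) EFin_primitive//.
exact: bounded_measurable_density.
Qed.

Lemma cdf_lt s t : 0 <= s -> s < t -> t <= 1 -> cdf f s < cdf f t.
Proof.
move=> s0 st t1; have [c c01 fc] := EVT_min ler01 density_continuous.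
have [d _ fd] := EVT_max ler01 density_continuous.
have /andP[+ _] : f c * (t - s) <= primitive f t - primitive f s <=
    f d * (t - s).
  apply: primitive_sub_bounds => //; [exact: ltW|exact: bounded_measurable_density|].
  move=> x /andP[sx xt]; have x01 : x \in `[0, 1].
    by rewrite in_itv/=; apply/andP; split; lra.
  by rewrite fc ?fd.
have : 0 < f c * (t - s) by rewrite mulr_gt0 ?subr_gt0 ?(density_gt0 hf).
by rewrite -[cdf f s]/(primitive f s) -[cdf f t]/(primitive f t); lra.
Qed.

Lemma cdf_le s t : 0 <= s -> s <= t -> t <= 1 -> cdf f s <= cdf f t.
Proof.
move=> s0; rewrite le_eqVlt => /predU1P[->//|st] t1; exact/ltW/cdf_lt.
Qed.

Lemma cdf_continuous : {within `[0, 1], continuous (cdf f)}.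
Proof. exact: primitive_continuous bounded_measurable_density. Qed.

Lemma bounded_measurable_cdf : bounded_measurable (cdf f).
Proof. exact: bounded_measurable_continuous cdf_continuous. Qed.

(** G f with the division cleared: minus the derivative of t (1 - F t), the revenue of a posted
    price t. *)
Definition marginal_revenue t : R := t * f t - (1 - cdf f t).

Lemma virtual_valuationM t : t \in `[0, 1] ->
  virtual_valuation f t * f t = marginal_revenue t.
Proof.
move=> /(density_gt0 hf) ft; rewrite /virtual_valuation mulrBl divfK//.
by rewrite gt_eqF.
Qed.

Lemma marginal_revenue_continuous : {within `[0, 1], continuous marginal_revenue}.
Proof.
apply: within_continuousD.
  apply: within_continuousM density_continuous; exact: within_continuous_id.
apply: within_continuousN; apply: within_continuousD.
  exact: within_continuous_cst.
apply: within_continuousN; exact: cdf_continuous.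
Qed.

Lemma virtual_valuation_continuous :
  {within `[0, 1], continuous (virtual_valuation f)}.
Proof.
apply: within_continuousD; first exact: within_continuous_id.
apply/within_continuousN/within_continuousM; last first.
  apply: within_continuousV; first exact: density_continuous.
  by move=> x x01; rewrite gt_eqF// (density_gt0 hf).
apply: within_continuousD; first exact: within_continuous_cst.
apply: within_continuousN; exact: cdf_continuous.
Qed.

Let theta0_gt0 : 0 < theta0.
Proof. by have := virtual_valuation_in hf; rewrite in_itv/= => /andP[]. Qed.

Let theta0_lt1 : theta0 < 1.
Proof. by have := virtual_valuation_in hf; rewrite in_itv/= => /andP[]. Qed.

Lemma virtual_valuation0_lt0 : virtual_valuation f 0 < 0.
Proof.
rewrite /virtual_valuation cdf0 subr0 sub0r oppr_lt0 mulr_gt0 ?invr_gt0//.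
by apply: (density_gt0 hf); rewrite in_itv/= lexx ler01.
Qed.

Lemma virtual_valuation1 : virtual_valuation f 1 = 1.
Proof. by rewrite /virtual_valuation cdf1 subrr mul0r subr0. Qed.

(** G is negative at 0, so a nonnegative value at t would produce, by the intermediate value
    theorem, a second zero in ]0, 1[. *)
Lemma virtual_valuation_lt0 t : 0 <= t -> t < theta0 -> virtual_valuation f t < 0.
Proof.
move=> t0 tth; rewrite ltNge; apply/negP => Gt.
have cG : {within `[0, t], continuous (virtual_valuation f)}.
  apply: continuous_subspaceW virtual_valuation_continuous.
  by apply: subset_itvl; rewrite bnd_simp; have := theta0_lt1; lra.
have G0 := virtual_valuation0_lt0.
have [|c] := IVT (v := 0) t0 cG; first by rewrite ge_min (ltW G0)/= le_max Gt orbT.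
rewrite in_itv/= => /andP[c0 ct] Gc.
have cn0 : c != 0 by apply/eqP => c00; move: G0; rewrite c00 in Gc; rewrite Gc ltxx.
have c01 : c \in `]0, 1[.
  rewrite in_itv/= lt_neqAle eq_sym cn0 c0/=.
  by have := theta0_lt1; lra.
by have := virtual_valuation_uniq hf c01 Gc; lra.
Qed.

Lemma virtual_valuation_lt s t : theta0 <= s -> s < t -> t <= 1 ->
  virtual_valuation f s < virtual_valuation f t.
Proof.
move=> s0 st t1.
have cG : {within `[theta0, 1], continuous (virtual_valuation f)}.
  apply: continuous_subspaceW virtual_valuation_continuous.
  by apply: subset_itvr; rewrite bnd_simp ltW.
apply: (incr_itv_closure theta0_lt1 cG) => //.
- by move=> x y xi yi; exact: (virtual_valuation_incr hf).
- by rewrite in_itv/= s0; lra.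
- by rewrite in_itv/= t1 andbT; lra.
Qed.

Lemma virtual_valuation_le s t : theta0 <= s -> s <= t -> t <= 1 ->
  virtual_valuation f s <= virtual_valuation f t.
Proof.
move=> s0; rewrite le_eqVlt => /predU1P[->//|st] t1.
exact/ltW/virtual_valuation_lt.
Qed.

(** G may oscillate below [theta0], but it is negative there and nonnegative afterwards, so a larger
    type above [theta0] still has the larger value. *)
Lemma virtual_valuation_lt_above s t : 0 <= s -> s < t -> theta0 <= t -> t <= 1 ->
  virtual_valuation f s < virtual_valuation f t.
Proof.
move=> s0 st tt t1; have [ts|ts] := leP theta0 s.
  exact: virtual_valuation_lt.
apply: (lt_le_trans (virtual_valuation_lt0 s0 ts)).
by rewrite -(virtual_valuation_zero hf) virtual_valuation_le.
Qed.

Lemma virtual_valuation_zero_unique t : t \in `[0, 1] ->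
  virtual_valuation f t = 0 -> t = theta0.
Proof.
rewrite in_itv/= => /andP[t0 t1] Gt.
have [/(virtual_valuation_lt0 t0)|tt|//] := ltgtP t theta0.
  by rewrite Gt ltxx.
have := virtual_valuation_lt (lexx _) tt t1.
by rewrite (virtual_valuation_zero hf) Gt ltxx.
Qed.

End Density.

(** * The Lagrangian y v - w in the congestion level and the inverse of h *)

Section Market.
Context {R : realType} {v : R -> R} {w : R -> \bar R} {h0 : \bar R} {h1 : R}.
Hypotheses (hv : utility_function v) (hw : capacity_function w).
Hypothesis hh : regular_virtual_capacity v w h0 h1.
Implicit Types x y z : R.
Local Notation h := (virtual_capacity v w).
Local Notation hbar := (virtual_capacity_ext v w h0 h1).
Local Notation W := (fine \o w).

Let unit0 : 0 \in `[0, 1 : R].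
Proof. by rewrite in_itv/= lexx ler01. Qed.

Let unit1 : 1 \in `[0, 1 : R].
Proof. by rewrite in_itv/= lexx ler01. Qed.

Lemma utility_le x y : x \in `[0, 1] -> y \in `[0, 1] -> x <= y -> v y <= v x.
Proof.
move=> x01 y01; rewrite le_eqVlt => /predU1P[->//|xy].
exact/ltW/(utility_decr hv).
Qed.

Lemma utility_bounds x : x \in `[0, 1] -> 0 <= v x <= 1.
Proof.
move=> x01; have := utility_le unit0 x01; have := utility_le x01 unit1.
by rewrite (utility_1 hv) (utility_0 hv) !(itvP x01) => -> // ->.
Qed.

Lemma utility_continuous : {within `[0, 1], continuous v}.
Proof. exact: continuously_differentiable_continuous (utility_C1 hv). Qed.

Let nbhs_oo x (a b : R) : x \in `]a, b[ -> nbhs x `]a, b[%classic.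
Proof. exact: near_in_itvoo. Qed.

Lemma utility_derivable x : x \in `]0, 1[ -> derivable v x 1.
Proof.
move=> /nbhs_oo x01; apply: continuously_differentiable_derivable (utility_C1 hv).
by apply: filterS x01; apply: subset_itv_oo_cc.
Qed.

Lemma utility_derive_lt0 x : x \in `]0, 1[ -> derive1 v x < 0.
Proof.
move=> x01; rewrite lt_neqAle (utility_derive_neq0 hh)//=.
apply: (@decr_derive1_le0_itv _ _ true false 0 1) => // [y|y z y01 z01 yz].
  by rewrite inE; exact: utility_derivable.
by apply: (utility_decr hv).
Qed.

Lemma capacity_derivable x : x \in `]0, 1[ -> derivable W x 1.
Proof.
move=> /nbhs_oo x01; case: (capacity_C1 hw) => [[_ dw]|[_ dw _]].
  apply: continuously_differentiable_derivable dw.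
  by apply: filterS x01; apply: subset_itv_oo_cc.
apply: continuously_differentiable_derivable dw.
by apply: filterS x01; apply: subset_itv_oo_oc.
Qed.

(** Finiteness at x rules out x = 0 when w is infinite there, keeping [x, 1] inside the domain of
    differentiability. *)
Lemma capacity_continuous x : 0 <= x -> w x \is a fin_num ->
  {within `[x, 1], continuous W}.
Proof.
move=> x0 wx; case: (capacity_C1 hw) => [[_ dw]|[w0 dw _]].
  apply: continuous_subspaceW (continuously_differentiable_continuous dw).
  by apply: subset_itvr; rewrite bnd_simp.
apply: continuous_subspaceW (continuously_differentiable_continuous dw).
apply: subset_itvr; rewrite bnd_simp lt_neqAle x0 andbT.
by apply: contraTneq wx => <-; rewrite w0.
Qed.

(* The Lagrangian y v - w has derivative v' (y - h), with v' < 0. *)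
Lemma lagrangian_mvt y a b : 0 <= a -> a < b -> b <= 1 -> w a \is a fin_num ->
  exists2 c, c \in `]a, b[ & (y * v b - W b) - (y * v a - W a) =
    (y - h c) * (derive1 v c * (b - a)).
Proof.
move=> a0 ab b1 wa.
have sub c : c \in `]a, b[ -> c \in `]0, 1[.
  by rewrite !in_itv/= => /andP[ac cb]; apply/andP; split; lra.
have dL c : c \in `]a, b[ ->
    is_derive c 1 (fun x => y * v x - W x) ((y - h c) * derive1 v c).
  move=> /sub c01; have dv := derivable_derive1 (utility_derivable c01).
  have dW := derivable_derive1 (capacity_derivable c01).
  have -> : (y - h c) * derive1 v c = y *: derive1 v c - derive1 W c.
    rewrite mulrBl /virtual_capacity divfK//.
    exact: (utility_derive_neq0 hh).
  apply: is_deriveB.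
have cL : {within `[a, b], continuous (fun x => y * v x - W x)}.
  apply: within_continuousD.
    apply: within_continuousM; first exact: within_continuous_cst.
    apply: continuous_subspaceW utility_continuous.
    by apply: subset_itvScc; rewrite bnd_simp.
  apply: within_continuousN; apply: continuous_subspaceW (capacity_continuous a0 wa).
  by apply: subset_itvl; rewrite bnd_simp.
have [c cab e] := MVT ab dL cL.
by exists c => //; rewrite e mulrA.
Qed.

Lemma lagrangian_lt y a b : 0 <= a -> a < b -> b <= 1 -> w a \is a fin_num ->
  (forall c, c \in `]a, b[ -> y < h c) -> y * v a - W a < y * v b - W b.
Proof.
move=> a0 ab b1 wa hy; have [c cab e] := lagrangian_mvt y a0 ab b1 wa.
rewrite -subr_gt0 e nmulr_rgt0 ?subr_lt0 ?hy//.
rewrite pmulr_llt0 ?subr_gt0//; apply: utility_derive_lt0.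
by move: cab; rewrite !in_itv/= => /andP[ac cb]; apply/andP; split; lra.
Qed.

Lemma lagrangian_gt y a b : 0 <= a -> a < b -> b <= 1 -> w a \is a fin_num ->
  (forall c, c \in `]a, b[ -> h c < y) -> y * v b - W b < y * v a - W a.
Proof.
move=> a0 ab b1 wa hy; have [c cab e] := lagrangian_mvt y a0 ab b1 wa.
rewrite -subr_lt0 e pmulr_rlt0 ?subr_gt0 ?hy//.
rewrite pmulr_llt0 ?subr_gt0//; apply: utility_derive_lt0.
by move: cab; rewrite !in_itv/= => /andP[ac cb]; apply/andP; split; lra.
Qed.

(** The limit only yields h (x / 2) <= h0; strictness comes from x / 2 < x. *)
Lemma virtual_capacity_lt0 x : x \in `]0, 1[ -> ((h x)%:E < h0)%E.
Proof.
move=> x01; have := x01; rewrite in_itv/= => /andP[x0 x1].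
have y01 : x / 2 \in `]0, 1[ by rewrite in_itv/=; apply/andP; split; lra.
apply: (@lt_le_trans _ _ (h (x / 2))%:E).
  by rewrite lte_fin (virtual_capacity_decr hh)//; lra.
apply: (cvge_to_ge (virtual_capacity_0 hh)).
near=> z; rewrite lee_fin; apply/ltW/(virtual_capacity_decr hh) => //.
  rewrite in_itv/=; apply/andP; split; first by near: z; exact: nbhs_right_gt.
  by near: z; apply: nbhs_right_lt.
by near: z; apply: nbhs_right_lt; lra.
Unshelve. all: by end_near. Qed.

Lemma virtual_capacity_gt1 x : x \in `]0, 1[ -> h1 < h x.
Proof.
move=> x01; have := x01; rewrite in_itv/= => /andP[x0 x1].
have y01 : (x + 1) / 2 \in `]0, 1[ by rewrite in_itv/=; apply/andP; split; lra.
apply: (@le_lt_trans _ _ (h ((x + 1) / 2))); last first.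
  by rewrite (virtual_capacity_decr hh)//; lra.
apply: (cvgr_to_le (virtual_capacity_1 hh)).
near=> z; apply/ltW/(virtual_capacity_decr hh) => //.
  rewrite in_itv/=; apply/andP; split; last by near: z; exact: nbhs_left_lt.
  by near: z; apply: nbhs_left_gt.
by near: z; apply: nbhs_left_gt; lra.
Unshelve. all: by end_near. Qed.

Lemma virtual_capacity_extE x : x \in `]0, 1[ -> hbar x = (h x)%:E.
Proof.
rewrite in_itv/= /virtual_capacity_ext => /andP[x0 x1].
by rewrite gt_eqF// lt_eqF.
Qed.

Lemma virtual_capacity_ext_lt x y : 0 <= x -> x < y -> y <= 1 ->
  (hbar y < hbar x)%E.
Proof.
move=> x0 xy y1.
have m01 : (x + y) / 2 \in `]0, 1[ by rewrite in_itv/=; apply/andP; split; lra.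
apply: (@lt_trans _ _ (h ((x + y) / 2))%:E).
  move: y1; rewrite le_eqVlt => /predU1P[y1|y1].
    rewrite {1}y1 /virtual_capacity_ext oner_eq0 eqxx lte_fin.
    by apply: virtual_capacity_gt1; rewrite in_itv/=; apply/andP; split; lra.
  have y01 : y \in `]0, 1[ by rewrite in_itv/=; apply/andP; split; lra.
  by rewrite virtual_capacity_extE// lte_fin (virtual_capacity_decr hh)//; lra.
move: x0; rewrite le_eqVlt => /predU1P[x0|x0].
  rewrite -{2}x0 /virtual_capacity_ext eqxx.
  by apply: virtual_capacity_lt0; rewrite in_itv/=; apply/andP; split; lra.
have x01 : x \in `]0, 1[ by rewrite in_itv/=; apply/andP; split; lra.
by rewrite virtual_capacity_extE// lte_fin (virtual_capacity_decr hh)//; lra.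
Qed.

(* Otherwise w - h0 v would be nondecreasing, hence bounded near 0. *)
Lemma virtual_capacity_pinfty : w 0 = +oo%E -> h0 = +oo%E.
Proof.
move=> w0; case e : h0 (virtual_capacity_0_gt0 hh) => [r| |]// _.
have r0 : 0 < r by move: (virtual_capacity_0_gt0 hh); rewrite e lte_fin.
case: (capacity_C1 hw) => [[]|[_ _]]; first by rewrite w0.
pose a : R := 1 / 2.
have a01 : a \in `]0, 1] by rewrite in_itv/=; apply/andP; split; rewrite /a; lra.
(* The comparison below and 0 <= v <= 1 give [W x < r + W a], which this threshold exceeds. *)
move=> /cvgey_ge/(_ (r + W a + 1)) big.
suff : \forall x \near (0 : R)^'+, False by move=> /filter_ex[].
near=> x.
have x0 : 0 < x by near: x; exact: nbhs_right_gt.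
have xa : x < a by near: x; apply: nbhs_right_lt; rewrite /a; lra.
have x01 : x \in `]0, 1] by rewrite in_itv/= x0; move: xa; rewrite /a; lra.
have wx := capacity_fin hw x01.
have : ((r + W a + 1)%:E <= w x)%E by near: x.
rewrite -(fineK wx) lee_fin.
have : r * v a - W a < r * v x - W x.
  apply: (lagrangian_gt (ltW x0) xa _ wx); first by rewrite /a; lra.
  move=> c; rewrite in_itv/= => /andP[xc ca]; rewrite -lte_fin -e.
  apply: virtual_capacity_lt0; rewrite in_itv/=.
  by apply/andP; split; move: ca; rewrite /a; lra.
have /andP[va _] : 0 <= v a <= 1.
  by apply: utility_bounds; rewrite in_itv/= /a; apply/andP; split; lra.
have /andP[_ vx] : 0 <= v x <= 1.
  by apply: utility_bounds; rewrite in_itv/=; apply/andP; split; move: xa; rewrite /a; lra.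
have := mulr_ge0 (ltW r0) va; have := ler_wpM2l (ltW r0) vx.
by rewrite /= mulr1; lra.
Unshelve. all: by end_near. Qed.

Local Notation hinv := (virtual_capacity_inv v w h0 h1).

Lemma virtual_capacity_inv_in y x : hinv y x -> x \in `[0, 1].
Proof. by rewrite /virtual_capacity_inv; case: ifPn => [_ ->|_ []]. Qed.

(** With [virtual_capacity_inv_gt0], these are the first-order conditions for maximizing y v - w at
    x: the inequality can be strict only at the corner x = 0. *)
Lemma virtual_capacity_inv_ge y x : hinv y x -> (hbar x <= y%:E)%E.
Proof.
rewrite /virtual_capacity_inv; case: ifPn => [/ltW hy ->|_ [_ ->]//].
by rewrite /virtual_capacity_ext eqxx.
Qed.

Lemma virtual_capacity_inv_gt0 y x : hinv y x -> 0 < x -> hbar x = y%:E.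
Proof.
by rewrite /virtual_capacity_inv; case: ifPn => [_ ->|_ [_ ->]//]; rewrite ltxx.
Qed.

(** The only danger is x = 0 with w infinite; then h0 is infinite too, and no real y is mapped to
    0. *)
Lemma virtual_capacity_inv_fin y x : hinv y x -> w x \is a fin_num.
Proof.
move=> yx; have := virtual_capacity_inv_in yx; rewrite in_itv/= => /andP[].
rewrite le_eqVlt => /predU1P[x0|x0] x1; last first.
  by apply: (capacity_fin hw); rewrite in_itv/= x0.
case: (capacity_C1 hw) => [[]|[]]; first by rewrite -x0.
move=> /virtual_capacity_pinfty h0y _ _.
have := virtual_capacity_inv_ge yx.
by rewrite /virtual_capacity_ext -x0 eqxx h0y.
Qed.

(** To the right of x, h < y and the Lagrangian decreases; to the left, which exists only if x > 0,
    y = hbar x < h and it increases. *)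
Lemma virtual_capacity_inv_max y x z : hinv y x -> z \in `[0, 1] ->
  w z \is a fin_num -> y * v z - W z <= y * v x - W x.
Proof.
move=> yx; rewrite in_itv/= => /andP[z0 z1] wz.
have := virtual_capacity_inv_in yx; rewrite in_itv/= => /andP[x0 x1].
have [xz|zx|->//] := ltgtP x z; apply/ltW.
  apply: lagrangian_gt => //; first exact: virtual_capacity_inv_fin yx.
  move=> c; rewrite in_itv/= => /andP[xc cz]; rewrite -lte_fin.
  rewrite -virtual_capacity_extE; last by rewrite in_itv/=; apply/andP; split; lra.
  apply: lt_le_trans (virtual_capacity_inv_ge yx).
  by apply: virtual_capacity_ext_lt => //; lra.
apply: lagrangian_lt => // c; rewrite in_itv/= => /andP[zc cx]; rewrite -lte_fin.
rewrite -virtual_capacity_extE; last by rewrite in_itv/=; apply/andP; split; lra.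
rewrite -(virtual_capacity_inv_gt0 yx); last by lra.
by apply: virtual_capacity_ext_lt => //; lra.
Qed.

Lemma virtual_capacity_inv_le y1 y2 x1 x2 : hinv y1 x1 -> hinv y2 x2 ->
  y2 <= y1 -> x1 <= x2.
Proof.
move=> i1 i2 y21; rewrite leNgt; apply/negP => x21.
have := virtual_capacity_inv_in i1; rewrite in_itv/= => /andP[_ x11].
have := virtual_capacity_inv_in i2; rewrite in_itv/= => /andP[x20 _].
have := virtual_capacity_ext_lt x20 x21 x11.
rewrite (virtual_capacity_inv_gt0 i1 (le_lt_trans x20 x21)) ltNge => /negP; apply.
by apply: (le_trans (virtual_capacity_inv_ge i2)); rewrite lee_fin.
Qed.

(** Since y <= h1 < h on ]0, 1[, the Lagrangian increases strictly up to its value 0 at the dummy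
    class. *)
Lemma lagrangian_lt_1 y z : y <= h1 -> 0 <= z -> z < 1 -> w z \is a fin_num ->
  y * v z < W z.
Proof.
move=> yh z0 z1 wz; rewrite -subr_lt0.
have -> : 0 = y * v 1 - W 1 by rewrite (utility_1 hv) /= (capacity_1 hw) mulr0 subr0.
apply: lagrangian_lt => // c; rewrite in_itv/= => /andP[zc c1].
apply: (le_lt_trans yh); apply: virtual_capacity_gt1.
by rewrite in_itv/=; apply/andP; split; lra.
Qed.

Lemma capacity0_gt0 : (0 < w 0%R)%E.
Proof.
have : (0 <= w 0%R)%E by apply: (capacity_ge0 hw).
have [w0 _|/negPn w0] := boolP (w 0 \is a fin_num); last first.
  by case: (w 0) w0.
(* For y = 0 the Lagrangian is - w. *)
have := @lagrangian_lt_1 0 0 (virtual_capacity_1_ge0 hh) (lexx _) ltr01 w0.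
by rewrite mul0r/= -lte_fin fineK.
Qed.

End Market.

(** * Implementable choices: envelope formula, revenue, prices and weak duality *)

(** Arithmetic of [envelope_revenue] on [s, t]: d is t - s, and X, Y are the increments of the
    integrals of g (1 - F) and U f. Each bracket is a difference of two quantities agreeing to first
    order; both leave an error d (Ft - Fs), whence the factor 2. *)
Lemma envelope_increment_bound (R : realType) (gs gt Us Ut Fs Ft X Y d : R) :
  0 <= d -> 0 <= gs -> gs <= 1 -> gt <= 1 -> gs <= gt ->
  0 <= Fs -> Fs <= Ft -> Ft <= 1 ->
  gs * d <= Ut - Us -> Ut - Us <= gt * d ->
  gs * (1 - Ft) * d <= X -> X <= gt * (1 - Fs) * d ->
  Us * (Ft - Fs) <= Y -> Y <= Ut * (Ft - Fs) ->
  `|(Ut - Us) * (1 - Ft) - X + (Y - Us * (Ft - Fs))| <=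
    d * (gt - gs + 2 * (Ft - Fs)).
Proof.
move=> d0 gs0 gs1 gt1 gst Fs0 Fst Ft1 U1 U2 X1 X2 Y1 Y2.
have Ft0 : 0 <= 1 - Ft by rewrite subr_ge0.
have dF0 : 0 <= Ft - Fs by rewrite subr_ge0.
have gt0 := le_trans gs0 gst.
have A1 : gs * (1 - Ft) * d <= (Ut - Us) * (1 - Ft) by rewrite mulrAC ler_wpM2r.
have A2 : (Ut - Us) * (1 - Ft) <= gt * (1 - Ft) * d.
  by rewrite [leRHS]mulrAC ler_wpM2r.
have A3 : (Ut - Us) * (Ft - Fs) <= d * (Ft - Fs).
  by rewrite ler_wpM2r// (le_trans U2)// ler_piMl.
have A4 : gt * (1 - Fs) - gs * (1 - Ft) <= gt - gs + (Ft - Fs).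
  have P1 : 0 <= Fs * (gt - gs) by rewrite mulr_ge0// subr_ge0.
  have P2 : 0 <= (1 - gs) * (Ft - Fs) by rewrite mulr_ge0// subr_ge0.
  by clear -P1 P2; lra.
have A5 := ler_wpM2l d0 A4.
have A6 : gt * (1 - Ft) * d <= gt * (1 - Fs) * d.
  by rewrite ler_wpM2r// ler_wpM2l// lerD2l lerN2.
have A7 : 0 <= d * (Ft - Fs) by rewrite mulr_ge0.
rewrite ler_norml; clear - A1 A2 A3 A5 A6 A7 X1 X2 Y1 Y2.
by apply/andP; split; lra.
Qed.

Section Mechanism.
Context {R : realType} {f v : R -> R} {w : R -> \bar R} {theta0 : R}.
Hypotheses (hf : user_density f theta0) (hv : utility_function v).
Hypothesis hw : capacity_function w.
Implicit Types (g U p q : R -> R) (Q : set R) (s t : R).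

Let unit0 : 0 \in `[0, 1 : R].
Proof. by rewrite in_itv/= lexx ler01. Qed.

Let unit1 : 1 \in `[0, 1 : R].
Proof. by rewrite in_itv/= lexx ler01. Qed.

Local Notation mr := (marginal_revenue (f := f)).

Lemma bounded_measurable_marginal_revenue : bounded_measurable mr.
Proof. exact/bounded_measurable_continuous/(marginal_revenue_continuous hf). Qed.

(** Preimages of upper rays are intervals. Extended values are needed because w (q t) may be
    infinite. *)
Lemma nondecreasing_emeasurable (e : R -> \bar R) :
  {in `[0, 1] &, {homo e : x y / x <= y >-> (x <= y)%E}} ->
  measurable_fun (`[0%R, 1%R]%classic : set R) e.
Proof.
move=> me.
apply: (measurability _ (ErealGenOInfty.measurableE R)) => //.
move=> /= _ [_ [r ->]] <-; apply: is_interval_measurable => x y /=.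
move=> [x01 +] [y01 _] z /andP[xz zy].
rewrite /= !in_itv/= !andbT => rx.
have z01 : z \in `[0, 1].
  by move: x01 y01; rewrite !in_itv/= => /andP[? _] /andP[_ ?]; apply/andP; split; lra.
by split => //; apply: (lt_le_trans rx); apply: me.
Qed.

Lemma measurable_usage q : (forall t, t \in `[0, 1] -> q t \in `[0, 1]) ->
  {in `[0, 1] &, {homo q : x y /~ x <= y}} ->
  measurable_fun (`[0%R, 1%R]%classic : set R) (fun t => w (q t) * (f t)%:E)%E.
Proof.
move=> q01 dq; apply: emeasurable_funM; last first.
  by apply/measurable_EFinP; exact: (bounded_measurable_density hf).1.
apply: nondecreasing_emeasurable => s t s01 t01 st.
by apply: (capacity_decr hw); rewrite ?q01//; exact: dq.
Qed.

(* A user of type t has utility U t, whose subgradient is g t = v (q t). *)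
Definition envelope g U : Prop :=
  U 0 = 0 /\
  forall s t, s \in `[0, 1] -> t \in `[0, 1] -> g s * (t - s) <= U t - U s.

Section Envelope.
Variables g U : R -> R.
Hypothesis gU : envelope g U.
Hypothesis g01 : forall t, t \in `[0, 1] -> 0 <= g t <= 1.

Lemma envelope_nondecreasing : {in `[0, 1] &, {homo g : x y / x <= y}}.
Proof.
move=> s t s01 t01; rewrite le_eqVlt => /predU1P[->//|st].
have := gU.2 _ _ s01 t01; have := gU.2 _ _ t01 s01 => h1 h2.
have : g s * (t - s) <= g t * (t - s) by lra.
by rewrite ler_pM2r// subr_gt0.
Qed.

Lemma envelope_utility_nondecreasing : {in `[0, 1] &, {homo U : x y / x <= y}}.
Proof.
move=> s t s01 t01 st; have /andP[gs0 _] := g01 s01.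
have := gU.2 _ _ s01 t01; have : 0 <= g s * (t - s) by rewrite mulr_ge0 ?subr_ge0.
by lra.
Qed.

Lemma bounded_measurable_envelope : bounded_measurable g.
Proof. exact/bounded_measurable_monotone/envelope_nondecreasing. Qed.

Lemma bounded_measurable_envelope_utility : bounded_measurable U.
Proof. exact/bounded_measurable_monotone/envelope_utility_nondecreasing. Qed.

(* Integrating by parts, U (1 - F) has derivative g (1 - F) - U f. *)
Lemma envelope_revenue :
  primitive (fun t => (t * g t - U t) * f t) 1 = primitive (fun t => g t * mr t) 1.
Proof.
have bg := bounded_measurable_envelope.
have bU := bounded_measurable_envelope_utility.
have bf := bounded_measurable_density hf.
have bF := bounded_measurable_cdf hf.
have bm := bounded_measurable_marginal_revenue.
have bid : bounded_measurable (fun x : R => x) by apply: bounded_measurable_monotone.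
have b1F : bounded_measurable (fun t => 1 - cdf f t).
  by apply: bounded_measurable_sub => //; exact: bounded_measurable_cst.
pose X := primitive (fun t => g t * (1 - cdf f t)).
pose Y := primitive (fun t => U t * f t).
have bX := bounded_measurable_mul bg b1F.
have bY := bounded_measurable_mul bU bf.
apply/eqP; rewrite -subr_eq0 -primitiveB//; last 2 first.
- apply: bounded_measurable_mul => //; apply: bounded_measurable_sub => //.
  exact: bounded_measurable_mul.
- exact: bounded_measurable_mul.
rewrite (@eq_primitive _ _ (fun t => g t * (1 - cdf f t) - U t * f t)); last first.
  by move=> t _; rewrite /marginal_revenue; ring.
rewrite primitiveB// subr_eq0; apply/eqP.
(* The defect in the integration by parts. The boundary terms vanish, at 0 because U 0 = 0 and at 1
   because F 1 = 1, so constancy of D means X 1 = Y 1. *)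
pose D t := U t * (1 - cdf f t) - (X t - Y t).
suff : D 1 = D 0.
  rewrite /D (cdf1 hf) subrr mulr0 gU.1 mul0r /X /Y !primitive0 -/(X 1) -/(Y 1).
  by lra.
apply: (eq_of_small_increments (k := fun t => g t + 2 * cdf f t)) => s t s0 st t1.
have t0 := le_trans s0 st; have s1 := le_trans st t1.
have s01 : s \in `[0, 1] by rewrite in_itv/= s0.
have t01 : t \in `[0, 1] by rewrite in_itv/= t0.
have gst : g s <= g t by apply: envelope_nondecreasing.
have Ust : U s <= U t by apply: envelope_utility_nondecreasing.
have /andP[gs0 gs1] := g01 s01; have /andP[gt0 gt1] := g01 t01.
have Fst : cdf f s <= cdf f t by apply: (cdf_le hf).
have F1 : cdf f t <= 1 by rewrite -(cdf1 hf); apply: (cdf_le hf).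
have F0 : 0 <= cdf f s by rewrite -(cdf0 (f := f)); apply: (cdf_le hf).
have in01 x : s < x <= t -> x \in `[0, 1].
  by move=> /andP[sx xt]; rewrite in_itv/= (le_trans s0 (ltW sx)) (le_trans xt).
have /andP[X1 X2] : g s * (1 - cdf f t) * (t - s) <= X t - X s <=
    g t * (1 - cdf f s) * (t - s).
  apply: primitive_sub_bounds => // x sxt; have x01 := in01 _ sxt.
  have /andP[sx xt] := sxt.
  have gsx : g s <= g x by apply: envelope_nondecreasing => //; exact: ltW.
  have gxt : g x <= g t by apply: envelope_nondecreasing.
  have Fsx : cdf f s <= cdf f x by apply: (cdf_le hf); rewrite ?(itvP x01)// ltW.
  have Fxt : cdf f x <= cdf f t by apply: (cdf_le hf); rewrite ?(itvP x01).
  have Fx1 := le_trans Fxt F1.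
  by rewrite !ler_pM ?subr_ge0 ?lerD2l ?lerN2// (le_trans gs0).
have YZ c : bounded_measurable (fun x => c * f x).
  by apply: bounded_measurable_mul => //; exact: bounded_measurable_cst.
have Y1 : U s * (cdf f t - cdf f s) <= Y t - Y s.
  rewrite mulrBr -!(primitiveZ (g := f))//.
  apply: le_primitive_sub => // x sxt; have x01 := in01 _ sxt.
  rewrite ler_pM2r ?(density_gt0 hf)//; apply: envelope_utility_nondecreasing => //.
  by case/andP : sxt => /ltW.
have Y2 : Y t - Y s <= U t * (cdf f t - cdf f s).
  rewrite mulrBr -!(primitiveZ (g := f))//.
  apply: le_primitive_sub => // x sxt; have x01 := in01 _ sxt.
  rewrite ler_pM2r ?(density_gt0 hf)//; apply: envelope_utility_nondecreasing => //.
  by case/andP : sxt.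
have U1 := gU.2 _ _ s01 t01; have U2 := gU.2 _ _ t01 s01.
have -> : D t - D s = ((U t - U s) * (1 - cdf f t) - (X t - X s)) +
    ((Y t - Y s) - U s * (cdf f t - cdf f s)) by rewrite /D; ring.
have -> : (t - s) * (g t + 2 * cdf f t - (g s + 2 * cdf f s)) =
  (t - s) * (g t - g s + 2 * (cdf f t - cdf f s)) by ring.
apply: envelope_increment_bound => //; first by rewrite subr_ge0.
by have := U2; lra.
Qed.

End Envelope.

Section UserChoice.
Variables (Q : set R) (p q : R -> R).
Hypotheses (hQ : strategy Q p) (hq : user_choice v Q p q).

Lemma user_choice_in t : t \in `[0, 1] -> q t \in `[0, 1].
Proof.
case: hQ => Q01 _ _ /hq [[->//|/Q01//] _].
Qed.

(** The subgradient inequality says that t does not gain by imitating s. Type 0 gets 0 because the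
    dummy class is free and prices are nonnegative. *)
Lemma user_choice_envelope :
  envelope (fun t => v (q t)) (fun t => t * v (q t) - p (q t)).
Proof.
have [Q01 p0 p1] := hQ; split; last first.
  by move=> s t s01 t01; have := (hq t01).2 _ (hq s01).1; lra.
have := (hq unit0).2 1 (or_introl erefl); rewrite !mul0r p1 => P.
have [[->|/p0]] := hq unit0; last by lra.
by rewrite p1 subrr.
Qed.

Let g01 t : t \in `[0, 1] -> 0 <= v (q t) <= 1.
Proof. by move=> t01; apply: (utility_bounds hv); exact: user_choice_in. Qed.

Lemma user_choice_revenue :
  revenue f p q = (primitive (fun t => v (q t) * mr t) 1)%:E.
Proof.
have bU := bounded_measurable_envelope_utility user_choice_envelope g01.
rewrite -(envelope_revenue user_choice_envelope g01) /revenue EFin_primitive.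
  by congr EFin; apply: eq_primitive => t _; ring.
apply: bounded_measurable_mul (bounded_measurable_density hf).
have bid : bounded_measurable (fun x : R => x) by apply: bounded_measurable_monotone.
have bg := bounded_measurable_envelope user_choice_envelope.
apply: bounded_measurable_eq (bounded_measurable_sub (bounded_measurable_mul bid bg) bU).
by move=> t _ /=; ring.
Qed.

Lemma user_choice_nonincreasing s t : s \in `[0, 1] -> t \in `[0, 1] ->
  s <= t -> q t <= q s.
Proof.
move=> s01 t01 st; rewrite leNgt; apply/negP => qst.
have := envelope_nondecreasing user_choice_envelope s01 t01 st.
by rewrite leNgt => /negP; apply; apply: (utility_decr hv) => //; exact: user_choice_in.
Qed.

End UserChoice.

(* The price of x is the least one for which no type gains by deviating to x. *)
Lemma implementable q : (forall t, t \in `[0, 1] -> q t \in `[0, 1]) ->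
  {in `[0, 1] &, {homo q : x y /~ x <= y}} ->
  exists p, strategy `[0, 1] p /\ user_choice v `[0, 1] p q.
Proof.
move=> q01 dq; pose g t := v (q t).
have mg : {in `[0, 1] &, {homo g : x y / x <= y}}.
  by move=> s t s01 t01 st; apply: (utility_le hv); rewrite ?q01//; exact: dq.
have bg := bounded_measurable_monotone mg.
have g01 t : t \in `[0, 1] -> 0 <= g t <= 1.
  by move=> t01; apply: (utility_bounds hv); exact: q01.
pose U := primitive g.
have UE : envelope g U.
  split; first exact: primitive0.
  move=> s t s01 t01.
  have := s01; have := t01; rewrite !in_itv/= => /andP[t0 t1] /andP[s0 s1].
  have [st|ts] := leP s t.
    have /andP[//] : g s * (t - s) <= U t - U s <= g t * (t - s).
    apply: primitive_sub_bounds => // x /andP[sx xt].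
    have x01 : x \in `[0, 1] by rewrite in_itv/=; apply/andP; split; lra.
    by rewrite !mg// ltW.
  have /andP[_] : g t * (s - t) <= U s - U t <= g s * (s - t).
    apply: primitive_sub_bounds => //; first exact: ltW.
    move=> x /andP[tx xs].
    have x01 : x \in `[0, 1] by rewrite in_itv/=; apply/andP; split; lra.
    by rewrite !mg// ltW.
  by lra.
have U0 t : t \in `[0, 1] -> 0 <= U t.
  move=> t01; rewrite -UE.1; apply: (envelope_utility_nondecreasing UE) => //.
  by rewrite (itvP t01).
pose S x := [set t * v x - U t | t in `[0, 1]].
pose p x := sup (S x).
have pub x t : x \in `[0, 1] -> t \in `[0, 1] -> t * v x - U t <= p x.
  move=> x01 t01; apply: sup_upper_bound; last by exists t.
  split; first by exists (t * v x - U t), t.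
  exists 1 => _ [s s01 <-]; have := U0 s s01.
  have /andP[vx0 vx1] := utility_bounds hv x01.
  have : s * v x <= 1 * 1 by apply: ler_pM => //; rewrite (itvP s01).
  by lra.
have plub x r : (forall t, t \in `[0, 1] -> t * v x - U t <= r) -> p x <= r.
  move=> H; apply: ge_sup; first by exists (0 * v x - U 0), 0.
  by move=> _ [t t01 <-]; exact: H.
(* The supremum defining p (q t) is attained at t itself, by the subgradient inequality. *)
have pq t : t \in `[0, 1] -> p (q t) = t * v (q t) - U t.
  move=> t01; apply/eqP; rewrite eq_le pub ?q01// andbT; apply: plub => s s01.
  by have := UE.2 _ _ t01 s01; rewrite /g; lra.
exists p; split.
  (* Type 0, with U 0 = 0, witnesses p >= 0; at class 1, v 1 = 0 and U >= 0 force p 1 = 0. *)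
  split => //.
    by move=> x x01; have := pub x 0 x01 unit0; rewrite UE.1; lra.
  apply/eqP; rewrite eq_le; apply/andP; split.
    by apply: plub => t /U0; rewrite (utility_1 hv); lra.
  by have := pub 1 0 unit1 unit0; rewrite UE.1; lra.
move=> t t01; split; first by right; exact: q01.
move=> x xQ; have x01 : x \in `[0, 1] by case: xQ => [->|].
by rewrite pq//; have := pub x t x01 t01; lra.
Qed.

(* Weak duality for the Lagrangian with multiplier mu, with pointwise slack e. *)
Lemma lagrangian_revenue (mu C : R) (e q q' : R -> R) : 0 < mu ->
  (forall t, t \in `[0, 1] -> q t \in `[0, 1]) ->
  {in `[0, 1] &, {homo q : x y /~ x <= y}} ->
  (forall t, t \in `[0, 1] -> q' t \in `[0, 1]) ->
  {in `[0, 1] &, {homo q' : x y /~ x <= y}} ->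
  (capacity_usage f w q <= C%:E)%E -> capacity_usage f w q' = C%:E ->
  bounded_measurable e -> (forall t, t \in `[0, 1] -> 0 <= e t) ->
  (forall t, t \in `[0, 1] -> w (q' t) \is a fin_num) ->
  (forall t, t \in `[0, 1] -> w (q t) \is a fin_num ->
    virtual_valuation f t * v (q t) + e t + mu * fine (w (q' t)) <=
    virtual_valuation f t * v (q' t) + mu * fine (w (q t))) ->
  primitive (fun t => v (q t) * mr t) 1 + primitive (fun t => e t * f t) 1 <=
  primitive (fun t => v (q' t) * mr t) 1.
Proof.
move=> mu0 q01 dq q'01 dq' uq uq' be e0 wq' H.
have bf := bounded_measurable_density hf.
have bvq k : (forall t, t \in `[0, 1] -> k t \in `[0, 1]) ->
    {in `[0, 1] &, {homo k : x y /~ x <= y}} ->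
    bounded_measurable (fun t => v (k t) * mr t).
  move=> k01 dk; apply: bounded_measurable_mul bounded_measurable_marginal_revenue.
  apply: bounded_measurable_monotone => s t s01 t01 st.
  by apply: (utility_le hv); rewrite ?k01//; exact: dk.
have bX := bvq q q01 dq; have bX' := bvq q' q'01 dq'.
have [_ [K1 hK1]] := bX; have [_ [K2 hK2]] := bX'.
have bef := bounded_measurable_mul be bf.
have bXe := bounded_measurable_add bX bef.
(* Adding K to both sides makes the integrands nonnegative, as additivity over a possibly infinite
   usage requires; K cancels at the end. *)
pose K := K1 + K2.
have K10 : 0 <= K1 by apply: le_trans (hK1 0 unit0).
have K20 : 0 <= K2 by apply: le_trans (hK2 0 unit0).
have bK := bounded_measurable_cst K.
have bA := bounded_measurable_add bXe bK; have bB := bounded_measurable_add bX' bK.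
pose A t := v (q t) * mr t + e t * f t + K; pose B t := v (q' t) * mr t + K.
have A0 t : t \in `[0, 1] -> 0 <= A t.
  move=> t01; have := hK1 t t01; rewrite ler_norml => /andP[P _].
  have := mulr_ge0 (e0 _ t01) (ltW (density_gt0 hf t01)).
  by rewrite /A /K; lra.
have B0 t : t \in `[0, 1] -> 0 <= B t.
  move=> t01; have := hK2 t t01; rewrite ler_norml => /andP[P _].
  by rewrite /B /K; lra.
have W0 k t : (forall t, t \in `[0, 1] -> k t \in `[0, 1]) -> t \in `[0, 1] ->
    (0 <= w (k t) * (f t)%:E)%E.
  move=> k01 t01; rewrite mule_ge0 ?(capacity_ge0 hw) ?k01//.
  by rewrite lee_fin ltW// (density_gt0 hf).
have key : (\int[lebesgue_measure]_(t in `[0%R, 1%R])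
      ((A t)%:E + mu%:E * (w (q' t) * (f t)%:E)) <=
    \int[lebesgue_measure]_(t in `[0%R, 1%R])
      ((B t)%:E + mu%:E * (w (q t) * (f t)%:E)))%E.
  apply: ge0_le_integral => //.
  - move=> t t01; rewrite adde_ge0 ?lee_fin ?A0// mule_ge0 ?W0//.
    by rewrite lee_fin ltW.
  - apply: emeasurable_funD; first by apply/measurable_EFinP; exact: bA.1.
    by apply: emeasurable_funM; [exact: measurable_cst|exact: measurable_usage].
  - apply: emeasurable_funD; first by apply/measurable_EFinP; exact: bB.1.
    by apply: emeasurable_funM; [exact: measurable_cst|exact: measurable_usage].
  move=> t t01; have ft := density_gt0 hf t01.
  (* Where w (q t) is infinite the right-hand side is +oo. *)
  have [wq|wq] := boolP (w (q t) \is a fin_num); last first.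
    have -> : w (q t) = +oo%E.
      by have := capacity_ge0 hw (q01 _ t01); case: (w (q t)) wq.
    by rewrite gt0_mulye ?lte_fin// gt0_muley ?lte_fin// addey ?leey.
  rewrite -(fineK wq) -(fineK (wq' _ t01)) -!EFinM -!EFinD lee_fin.
  have := ler_wpM2r (ltW ft) (H t t01 wq).
  by rewrite /A /B -(virtual_valuationM hf t01); lra.
have split_usage (G k : R -> R) : bounded_measurable G ->
    (forall t, t \in `[0, 1] -> 0 <= G t) ->
    (forall t, t \in `[0, 1] -> k t \in `[0, 1]) ->
    {in `[0, 1] &, {homo k : x y /~ x <= y}} ->
    (\int[lebesgue_measure]_(t in `[0%R, 1%R])
      ((G t)%:E + mu%:E * (w (k t) * (f t)%:E)) =
    (primitive G 1)%:E + mu%:E * capacity_usage f w k)%E.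
  move=> bG G0 k01 dk; rewrite ge0_integralD//=.
  - rewrite EFin_primitive//; congr (_ + _)%E.
    apply: ge0_integralZl => //; [exact: measurable_usage|by move=> t; exact: W0|].
    by rewrite lee_fin ltW.
  - by apply/measurable_EFinP; exact: bG.1.
  - by move=> t t01; rewrite mule_ge0 ?W0// lee_fin ltW.
  - by apply: emeasurable_funM; [exact: measurable_cst|exact: measurable_usage].
move: key; rewrite !split_usage// uq' => key.
have mu0' : (0 <= mu%:E)%E by rewrite lee_fin ltW.
have := le_trans key (leeD2l _ (lee_wpmul2l mu0' uq)).
rewrite -!EFinM -!EFinD lee_fin lerD2r.
have eA : primitive A 1 = primitive (fun t => v (q t) * mr t) 1 +
   primitive (fun t => e t * f t) 1 + K * 1.
  by rewrite (primitiveD ler01 (lexx 1) bXe bK) (primitiveD ler01 (lexx 1) bX bef)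
    primitive_cst.
have eB : primitive B 1 = primitive (fun t => v (q' t) * mr t) 1 + K * 1.
  by rewrite (primitiveD ler01 (lexx 1) bX' bK) primitive_cst.
by rewrite eA eB lerD2r.
Qed.

End Mechanism.

(** * The solution of the optimality system: opting out, monotonicity and limit in the capacity *)

Section Solution.
Context {R : realType} {f v : R -> R} {w : R -> \bar R} {theta0 : R}.
Context {h0 : \bar R} {h1 : R}.
Hypotheses (hf : user_density f theta0) (hv : utility_function v).
Hypothesis hw : capacity_function w.
Hypothesis hh : regular_virtual_capacity v w h0 h1.
Implicit Types (p q : R -> R) (Q : set R) (s t : R).
Local Notation G := (virtual_valuation f).

Lemma theta0_itv : 0 < theta0 < 1.
Proof. by have := virtual_valuation_in hf; rewrite in_itv. Qed.

Section OneCapacity.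
Variables (C : R) (q : R -> R) (that mu : R).
Hypothesis hs : optimality_system f v w theta0 h0 h1 C q that mu.

Lemma marginal_user_itv : theta0 <= that <= 1.
Proof. by have := marginal_user_in hs; rewrite in_itv. Qed.

Lemma virtual_valuation_below t : 0 <= t -> t <= that -> G t <= mu * h1.
Proof.
have /andP[tt t1] := marginal_user_itv.
move=> t0; rewrite -(marginal_user_eq hs) le_eqVlt => /predU1P[->//|tth].
exact/ltW/(virtual_valuation_lt_above hf).
Qed.

Lemma choice_belowE t : 0 <= t -> t < that -> q t = 1.
Proof. by move=> t0 tt; apply: (choice_below hs); rewrite in_itv/= t0. Qed.

Lemma choice_aboveE t : that <= t -> t <= 1 ->
  virtual_capacity_inv v w h0 h1 (G t / mu) (q t).
Proof. by move=> tt t1; apply: (choice_above hs); rewrite in_itv/= tt. Qed.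

Lemma choice_in t : t \in `[0, 1] -> q t \in `[0, 1].
Proof.
rewrite {1}in_itv/= => /andP[t0 t1]; have [tt|tt] := leP that t.
  exact: virtual_capacity_inv_in (choice_aboveE tt t1).
by rewrite choice_belowE// in_itv/= lexx ler01.
Qed.

Lemma choice_fin t : t \in `[0, 1] -> w (q t) \is a fin_num.
Proof.
rewrite in_itv/= => /andP[t0 t1]; have [tt|tt] := leP that t.
  exact: (virtual_capacity_inv_fin hv hw hh (choice_aboveE tt t1)).
by rewrite choice_belowE// (capacity_1 hw).
Qed.

Lemma choice_nonincreasing : {in `[0, 1] &, {homo q : x y /~ x <= y}}.
Proof.
move=> t s t01 s01 st; have := t01; have := s01.
rewrite !in_itv/= => /andP[s0 s1] /andP[t0 t1].
have [ts|ts] := leP that s; last first.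
  by rewrite (choice_belowE s0 ts) (itvP (choice_in t01)).
apply: (virtual_capacity_inv_le hh (choice_aboveE _ t1) (choice_aboveE ts s1)).
  exact: le_trans ts st.
rewrite ler_pM2r ?invr_gt0 ?(shadow_price_gt0 hs)//.
apply: (virtual_valuation_le hf) => //.
by have /andP[+ _] := marginal_user_itv; move=> /le_trans; apply.
Qed.

Lemma choice_max t z : t \in `[0, 1] -> z \in `[0, 1] -> w z \is a fin_num ->
  G t * v z + mu * fine (w (q t)) <= G t * v (q t) + mu * fine (w z).
Proof.
move=> t01 z01 wz; have mu0 := shadow_price_gt0 hs.
pose y := G t / mu; have GE : G t = mu * y by rewrite mulrC divfK// gt_eqF.
suff : y * v z - fine (w z) <= y * v (q t) - fine (w (q t)).
  by move=> /(ler_wpM2l (ltW mu0)); rewrite GE; lra.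
have := t01; rewrite in_itv/= => /andP[t0 t1]; have [tt|tt] := leP that t.
  exact: (virtual_capacity_inv_max hv hw hh (choice_aboveE tt t1)).
rewrite choice_belowE// (utility_1 hv) (capacity_1 hw) mulr0 subrr.
have := z01; rewrite in_itv/= => /andP[z0].
rewrite le_eqVlt => /predU1P[->|z1].
  by rewrite (utility_1 hv) (capacity_1 hw) mulr0 subrr.
rewrite subr_le0; apply/ltW/(lagrangian_lt_1 hv hw hh) => //.
rewrite ler_pdivrMr// mulrC; apply: virtual_valuation_below => //; exact: ltW.
Qed.

(** If q' serves a type s below [that], it gives all of [s, [that][ a level at most q' s < 1. Each
    of these types loses at least a fixed amount in the Lagrangian, so q* earns strictly more. *)
Lemma optimal_below Q p q' : isp_optimal f v w C Q p q' ->
  forall t, 0 <= t -> t < that -> q' t = 1.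
Proof.
move=> [[hQ hq' uq'] opt] s s0 sth; apply/eqP/negPn/negP => q's.
have /andP[tth th1] := marginal_user_itv.
have s01 : s \in `[0, 1] by rewrite in_itv/= s0; lra.
have := user_choice_in hQ hq' s01; rewrite in_itv/= => /andP[q's0].
rewrite le_eqVlt (negbTE q's)/= => {q's} q's1.
have mu0 := shadow_price_gt0 hs.
have q'01 := user_choice_in hQ hq'.
have dq' : {in `[0, 1] &, {homo q' : x y /~ x <= y}}.
  by move=> y x y01 x01; apply: (user_choice_nonincreasing hv hQ hq').
(* The 1 / 2 keeps x0 away from 0, so that w x0 is finite even when q' s = 0. *)
pose x0 := Num.max (q' s) (1 / 2).
have x0s : q' s <= x0 by rewrite le_max lexx.
have x00 : 0 < x0 by rewrite lt_max; apply/orP; right; lra.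
have x01 : x0 < 1 by rewrite gt_max q's1/=; lra.
have wx0 : w x0 \is a fin_num by apply: (capacity_fin hw); rewrite in_itv/= x00 ltW.
pose gap := mu * (fine (w x0) - h1 * v x0).
have gap0 : 0 < gap.
  by rewrite mulr_gt0// subr_gt0 (lagrangian_lt_1 hv hw hh) ?(ltW x00).
(* The slack is [gap] on [s, [that][ and 0 elsewhere, written with two monotone steps to get
   measurability. *)
pose e t := gap * ((s <= t)%R%:R - (that <= t)%R%:R) : R.
have be : bounded_measurable e.
  apply: bounded_measurable_mul; first exact: bounded_measurable_cst.
  apply: bounded_measurable_sub; apply: bounded_measurable_monotone => x y _ _ xy.
    by rewrite ler_nat; case: (leP s x) => // sx; rewrite (le_trans sx xy).
  by rewrite ler_nat; case: (leP that x) => // sx; rewrite (le_trans sx xy).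
have eE t : s <= t -> t < that -> e t = gap.
  by move=> st tth'; rewrite /e st leNgt tth'/= subr0 mulr1.
have e0 t : 0 <= e t.
  rewrite /e mulr_ge0 ?(ltW gap0)// subr_ge0 ler_nat.
  by case: (leP that t) => // tht; rewrite (le_trans (ltW sth) tht).
have pgap t : t \in `[0, 1] -> w (q' t) \is a fin_num ->
    G t * v (q' t) + e t + mu * fine (w (q t)) <=
    G t * v (q t) + mu * fine (w (q' t)).
  move=> t01 wt; have := choice_max t01 (q'01 _ t01) wt.
  have := t01; rewrite in_itv/= => /andP[t0 t1].
  have [tht|tht] := leP that t.
    by rewrite /e tht (le_trans (ltW sth) tht) subrr mulr0 addr0.
  have [st|ts] := leP s t; last first.
    by rewrite /e [s <= t]leNgt ts [that <= t]leNgt tht/= subrr mulr0 addr0.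
  move=> _; rewrite eE// choice_belowE// (utility_1 hv) (capacity_1 hw) !mulr0 addr0 add0r.
  have q'ts : q' t <= q' s by apply: dq'.
  have := q'01 _ t01; rewrite in_itv/= => /andP[q't0 _].
  have /andP[vt0 _] := utility_bounds hv (q'01 _ t01).
  have L1 : G t * v (q' t) <= mu * h1 * v (q' t).
    by rewrite ler_wpM2r// virtual_valuation_below// ltW.
  (* The Lagrangian at y = h1 increases in the level, so its value at x0 bounds it for all levels q'
     t <= x0. *)
  have L2 : h1 * v (q' t) - fine (w (q' t)) <= h1 * v x0 - fine (w x0).
    have := le_trans q'ts x0s; rewrite le_eqVlt => /predU1P[->//|tx0].
    apply/ltW/(lagrangian_lt hv hw hh) => //; first exact: ltW.
    move=> c; rewrite in_itv/= => /andP[tc cx]; apply: (virtual_capacity_gt1 hh).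
    by rewrite in_itv/=; apply/andP; split; lra.
  have := ler_wpM2l (ltW mu0) L2; rewrite /gap.
  by move: L1; lra.
have [P [hP hPq]] := implementable hv choice_in choice_nonincreasing.
have feas : feasible f v w C `[0, 1] P q.
  by split => //; rewrite (capacity_binding hs).
have := opt _ _ _ feas; rewrite (user_choice_revenue hf hv hP hPq).
rewrite (user_choice_revenue hf hv hQ hq') lee_fin leNgt => /negP; apply.
apply: lt_le_trans (lagrangian_revenue hf hv hw mu0 q'01 dq' choice_in
  choice_nonincreasing uq' (capacity_binding hs) be (fun t _ => e0 t) choice_fin pgap).
(* Integrating up to m avoids the endpoint [that], where e is already 0; ]s, m] alone has positive
   mass. *)
rewrite ltrDl; pose m := (s + that) / 2.
have bf := bounded_measurable_density hf.
have bef := bounded_measurable_mul be bf.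
have b0 := bounded_measurable_cst (0 : R).
have ef0 x : x \in `[0, 1] -> 0 <= e x * f x.
  by move=> xi; rewrite mulr_ge0// ltW// (density_gt0 hf).
have sm : s < m by rewrite /m; lra.
have mth : m < that by rewrite /m; lra.
have I1 : 0 <= primitive (fun t => e t * f t) s.
  have -> : 0 = primitive (fun=> 0) s by rewrite primitive_cst// mul0r.
  apply: le_primitive => //; first lra.
  move=> x; rewrite in_itv/= => /andP[? ?]; apply: ef0.
  by rewrite in_itv/=; apply/andP; split; lra.
have I2 : primitive (fun t => gap * f t) m - primitive (fun t => gap * f t) s <=
    primitive (fun t => e t * f t) m - primitive (fun t => e t * f t) s.
  apply: le_primitive_sub => //; [lra|lra| |].
    by apply: bounded_measurable_mul => //; exact: bounded_measurable_cst.
  by move=> x /andP[sx xm]; rewrite eE//; lra.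
have I3 : primitive (fun=> 0) 1 - primitive (fun=> 0) m <=
    primitive (fun t => e t * f t) 1 - primitive (fun t => e t * f t) m.
  apply: le_primitive_sub => //; [lra|lra|].
  by move=> x /andP[? ?]; apply: ef0; rewrite in_itv/=; apply/andP; split; lra.
rewrite !primitive_cst ?mul0r// in I3; last by lra.
rewrite !primitiveZ// in I2; try lra.
have : 0 < gap * (cdf f m - cdf f s).
  by rewrite mulr_gt0// subr_gt0 (cdf_lt hf)//; lra.
rewrite -[cdf f m]/(primitive f m) -[cdf f s]/(primitive f s).
by lra.
Qed.

End OneCapacity.

Lemma capacity_usage_le q q' : (forall t, t \in `[0, 1] -> q t \in `[0, 1]) ->
  {in `[0, 1] &, {homo q : x y /~ x <= y}} ->
  (forall t, t \in `[0, 1] -> q' t \in `[0, 1]) ->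
  {in `[0, 1] &, {homo q' : x y /~ x <= y}} ->
  (forall t, t \in `[0, 1] -> q t <= q' t) ->
  (capacity_usage f w q' <= capacity_usage f w q)%E.
Proof.
move=> q01 dq q'01 dq' qq'.
have f0 t : t \in `[0, 1] -> (0 <= (f t)%:E)%E.
  by move=> t01; rewrite lee_fin ltW// (density_gt0 hf).
apply: ge0_le_integral => //; try exact: (measurable_usage hf hw).
- by move=> t t01; rewrite mule_ge0 ?f0// (capacity_ge0 hw)// q'01.
- move=> t t01; rewrite lee_wpmul2r ?f0// (capacity_decr hw)//.
  + exact: q01.
  + exact: q'01.
  + exact: qq'.
Qed.

Lemma shadow_price_decr C1 C2 q1 q2 that1 that2 mu1 mu2 :
  optimality_system f v w theta0 h0 h1 C1 q1 that1 mu1 ->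
  optimality_system f v w theta0 h0 h1 C2 q2 that2 mu2 ->
  C1 < C2 -> mu2 < mu1.
Proof.
move=> s1 s2 C12; rewrite ltNge; apply/negP => mu12.
have /andP[t01 t11] := marginal_user_itv s1.
have /andP[t02 t12] := marginal_user_itv s2.
have that12 : that1 <= that2.
  rewrite leNgt; apply/negP => that21.
  have := virtual_valuation_lt hf t02 that21 t11.
  rewrite (marginal_user_eq s1) (marginal_user_eq s2) ltNge => /negP; apply.
  by rewrite ler_wpM2r ?(virtual_capacity_1_ge0 hh).
have q12 t : t \in `[0, 1] -> q1 t <= q2 t.
  move=> t01'; have := t01'; rewrite in_itv/= => /andP[t0 t1].
  have [tt|tt] := leP that2 t; last first.
    by rewrite (choice_belowE s2 t0 tt) (itvP (choice_in s1 t01')).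
  apply: (virtual_capacity_inv_le hh (choice_aboveE s1 _ t1) (choice_aboveE s2 tt t1)).
    exact: le_trans that12 tt.
  (* The smaller price gives the larger G / mu because G >= 0 above [theta0]. *)
  rewrite ler_wpM2l ?lef_pV2 ?posrE ?(shadow_price_gt0 s1) ?(shadow_price_gt0 s2)//.
  rewrite -(virtual_valuation_zero hf) (virtual_valuation_le hf)//.
  exact: le_trans t02 tt.
have := capacity_usage_le (choice_in s1) (choice_nonincreasing s1) (choice_in s2)
  (choice_nonincreasing s2) q12.
by rewrite (capacity_binding s1) (capacity_binding s2) lee_fin leNgt C12.
Qed.

Lemma marginal_user_decr C1 C2 q1 q2 that1 that2 mu1 mu2 : 0 < h1 ->
  optimality_system f v w theta0 h0 h1 C1 q1 that1 mu1 ->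
  optimality_system f v w theta0 h0 h1 C2 q2 that2 mu2 ->
  C1 < C2 -> that2 < that1.
Proof.
move=> h10 s1 s2 C12; rewrite ltNge; apply/negP => that12.
have /andP[t01 t11] := marginal_user_itv s1.
have /andP[t02 t12] := marginal_user_itv s2.
have := virtual_valuation_le hf t01 that12 t12.
rewrite (marginal_user_eq s1) (marginal_user_eq s2) ler_pM2r// leNgt.
by rewrite (shadow_price_decr s1 s2 C12).
Qed.

Lemma max_capacity_gt0 : (0 < max_capacity f w theta0)%E.
Proof.
have /andP[t0 t1] := theta0_itv.
rewrite mule_gt0 ?(capacity0_gt0 hv hw hh)// lte_fin subr_gt0 -(cdf1 hf).
by apply: (cdf_lt hf) => //; exact: ltW.
Qed.

(* Serving only types above a cannot exhaust all capacities below the maximal one. *)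
Lemma marginal_user_close (a : R) : 0 < h1 -> theta0 < a -> a < 1 ->
  (forall C, 0 < C -> (C%:E < max_capacity f w theta0)%E -> exists q that mu,
     optimality_system f v w theta0 h0 h1 C q that mu /\ a <= that) -> False.
Proof.
move=> h10 ta a1 H; have /andP[t0 t1] := theta0_itv.
have bf := bounded_measurable_density hf.
have Fa : cdf f theta0 < cdf f a by apply: (cdf_lt hf) => //; exact: ltW.
have Fa1 : cdf f a < 1 by rewrite -(cdf1 hf); apply: (cdf_lt hf) => //; lra.
(* Only types above a consume capacity, each at most B. *)
have bound (C B : R) q that mu : optimality_system f v w theta0 h0 h1 C q that mu ->
    a <= that -> (forall t, that <= t -> t <= 1 -> (w (q t) <= B%:E)%E) ->
    0 <= B -> C <= B * (1 - cdf f a).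
  move=> s ath wB B0; have q01 := choice_in s.
  have bstep : bounded_measurable (fun t => (a <= t)%R%:R : R).
    apply: bounded_measurable_monotone => x y _ _ xy.
    by rewrite ler_nat; case: (leP a x) => // sx; rewrite (le_trans sx xy).
  have bB : bounded_measurable (fun t => (B * (a <= t)%R%:R) * f t).
    apply: bounded_measurable_mul => //.
    by apply: bounded_measurable_mul => //; exact: bounded_measurable_cst.
  have : (capacity_usage f w q <=
      \int[lebesgue_measure]_(t in `[0%R, 1%R]) ((B * (a <= t)%R%:R) * f t)%:E)%E.
    apply: ge0_le_integral => //.
    - move=> t t01; rewrite mule_ge0 ?(capacity_ge0 hw) ?q01//.
      by rewrite lee_fin ltW// (density_gt0 hf).
    - exact: (measurable_usage hf hw q01 (choice_nonincreasing s)).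
    - by apply/measurable_EFinP; exact: bB.1.
    move=> t t01; rewrite EFinM lee_wpmul2r//.
      by rewrite lee_fin ltW// (density_gt0 hf).
    have := t01; rewrite /= in_itv/= => /andP[tt0 tt1].
    have [tt|tt] := leP that t.
      by rewrite (le_trans ath tt) mulr1; exact: wB.
    by rewrite (choice_belowE s tt0 tt) (capacity_1 hw) lee_fin mulr_ge0.
  rewrite (capacity_binding s) EFin_primitive// lee_fin => /le_trans; apply.
  have E1 : primitive (fun t => (B * (a <= t)%R%:R) * f t) 1 -
      primitive (fun t => (B * (a <= t)%R%:R) * f t) a <=
      primitive (fun t => B * f t) 1 - primitive (fun t => B * f t) a.
    apply: le_primitive_sub => //; [lra|lra| |].
      by apply: bounded_measurable_mul => //; exact: bounded_measurable_cst.
    by move=> x /andP[ax _]; rewrite (ltW ax) mulr1.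
  have E2 : primitive (fun t => (B * (a <= t)%R%:R) * f t) a = 0.
    (* The step function is 1 at a itself, so this null endpoint is dropped first. *)
    rewrite /primitive -Rintegral_itv_bndo_bndc; last first.
      by apply: bounded_measurable_integrable => //; rewrite subitvE !bnd_simp ltW.
    rewrite (@eq_Rintegral _ _ _ _ _ (fun=> 0)); last first.
      move=> x; rewrite inE/= in_itv/= => /andP[_ xa].
      by rewrite leNgt xa mulr0 mul0r.
    by rewrite Rintegral_cst// mul0r.
  rewrite !primitiveZ// in E1; try lra.
  have := cdf1 hf; rewrite -[cdf f 1]/(primitive f 1) -[cdf f a]/(primitive f a).
  by move=> F1; rewrite F1 E2 in E1; lra.
have [w0|w0] := boolP (w 0 \is a fin_num).
  pose B := fine (w 0).
  have B0 : 0 < B by rewrite /B -lte_fin fineK// (capacity0_gt0 hv hw hh).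
  have cap : max_capacity f w theta0 = ((1 - cdf f theta0) * B)%:E.
    by rewrite /max_capacity EFinM fineK.
  (* The average puts C strictly between the bound B (1 - F a) and the maximal capacity. *)
  pose C := (1 - (cdf f theta0 + cdf f a) / 2) * B.
  have C0 : 0 < C by rewrite mulr_gt0//; lra.
  have [] := H C C0; first by rewrite cap lte_fin ltr_pM2r//; lra.
  move=> q [that [mu [s ath]]].
  have /andP[tt1 tt2] := marginal_user_itv s.
  suff : C <= B * (1 - cdf f a) by rewrite [B * _]mulrC ler_pM2r//; lra.
  apply: (bound _ B _ _ _ s ath); last exact: ltW.
  move=> t tt t1'; rewrite fineK//; have t01 : t \in `[0, 1] by rewrite in_itv/=; lra.
  have := choice_in s t01; rewrite in_itv/= => /andP[q0 q1].
  by apply: (capacity_decr hw) => //; rewrite in_itv/= ?lexx ?ler01// q0.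
have {}w0 : w 0 = +oo%E.
  by have := capacity0_gt0 hv hw hh; case: (w 0) w0.
have h0y := virtual_capacity_pinfty hv hw hh w0.
have cap : max_capacity f w theta0 = +oo%E.
  by rewrite /max_capacity w0 gt0_muley// lte_fin; lra.
have Ga : 0 < G a.
  by rewrite -(virtual_valuation_zero hf); apply: (virtual_valuation_lt hf) => //; exact: ltW.
(* A marginal type above a forces mu >= G a / h1, and G <= 1, so G t / mu <= h1 / G a < h x. Hence q
   t >= x for all served types, and w x bounds their consumption whatever C is. *)
have [x x01 hx] : exists2 x, x \in `]0, 1[ & h1 / G a < virtual_capacity v w x.
  have := virtual_capacity_0 hh; rewrite h0y => /cvgey_gt/(_ (h1 / G a)) hb.
  have : \forall x \near (0 : R)^'+,
      (x \in `]0, 1[) /\ (h1 / G a < virtual_capacity v w x).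
    near=> x; split.
      rewrite in_itv/=; apply/andP; split; first by near: x; exact: nbhs_right_gt.
      by near: x; apply: nbhs_right_lt.
    by rewrite -lte_fin; near: x.
  by move=> /filter_ex[x [? ?]]; exists x.
have := x01; rewrite in_itv/= => /andP[x0 x1].
have wx : w x \is a fin_num by apply: (capacity_fin hw); rewrite in_itv/= x0 ltW.
have wx0 : 0 <= fine (w x) by rewrite fine_ge0// (capacity_ge0 hw)// in_itv/= !ltW.
pose C := fine (w x) + 1.
have C0 : 0 < C by rewrite /C; lra.
have [|q [that [mu [s ath]]]] := H C C0; first by rewrite cap ltry.
have /andP[tt1 tt2] := marginal_user_itv s; have mu0 := shadow_price_gt0 s.
have muG : G a <= mu * h1.
  by rewrite -(marginal_user_eq s); apply: (virtual_valuation_le hf) => //; exact: ltW.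
have := bound _ (fine (w x)) _ _ _ s ath.
have : fine (w x) * (1 - cdf f a) < C.
  have Fa0 : 0 <= cdf f a.
    by rewrite -(cdf0 (f := f)); apply: (cdf_le hf) => //; lra.
  by have := mulr_ge0 wx0 Fa0; rewrite /C; lra.
rewrite ltNge => /negP nC bd; apply/nC/bd => // t tt t1'.
have t01 : t \in `[0, 1] by rewrite in_itv/=; lra.
have qt := choice_aboveE s tt t1'.
have := choice_in s t01; rewrite in_itv/= => /andP[q0 q1].
rewrite fineK//; apply: (capacity_decr hw); rewrite ?in_itv/= ?q0 ?(ltW x0) ?(ltW x1)//.
rewrite leNgt; apply/negP => qx.
have := virtual_capacity_ext_lt hh q0 qx (ltW x1).
rewrite virtual_capacity_extE// ltNge => /negP; apply.
apply: (le_trans (virtual_capacity_inv_ge qt)); rewrite lee_fin (le_trans _ (ltW hx))//.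
rewrite ler_pdivrMr// mulrAC ler_pdivlMr//.
have G1 : G t <= 1.
  rewrite -(virtual_valuation1 hf); apply: (virtual_valuation_le hf) => //.
  exact: le_trans tt1 tt.
by rewrite [h1 * mu]mulrC (le_trans _ muG)// ler_piMl// ltW.
Unshelve. all: by end_near. Qed.

End Solution.

(** * A second type distribution with the same G above theta0 *)

Section Tilt.
Context {R : realType}.
Implicit Types (A : set R) (g f : R -> R) (a s t x y : R).

(** The square of this positive part is continuously differentiable across the kink and vanishes
    from a on, so it perturbs a density below a only. *)
Definition below a x : R := Num.max (a - x) 0.

Lemma below_ge0 a x : 0 <= below a x.
Proof. by rewrite le_max lexx orbT. Qed.

Lemma below_le a x : 0 <= a -> 0 <= x -> below a x <= a.
Proof. by move=> a0 x0; rewrite ge_max a0 andbT gerBl. Qed.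

Lemma below_eq0 a x : a <= x -> below a x = 0.
Proof. by move=> ax; apply/max_idPr; rewrite subr_le0. Qed.

Lemma belowE a x : x <= a -> below a x = a - x.
Proof. by move=> xa; apply/max_idPl; rewrite subr_ge0. Qed.

Lemma below_continuous a : continuous (below a).
Proof.
move=> x; apply: (@continuous_max _ _ (fun y => a - y) (cst 0)); last exact: cvg_cst.
by apply: cvgB; [exact: cvg_cst|exact: cvg_id].
Qed.

(** The derivative - 2 [below] is Lipschitz with constant 2, which bounds the first-order remainder
    by (y - x)^2. *)
Lemma below_sqr_taylor a x y :
  `|below a y ^+ 2 - below a x ^+ 2 + 2 * below a x * (y - x)| <= (y - x) ^+ 2.
Proof.
have S1 := sqr_ge0 (y - x); have S2 := sqr_ge0 (a - x).
have S3 := sqr_ge0 (a - y); rewrite ler_norml.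
have [xa|xa] := leP x a; have [ya|ya] := leP y a.
- by rewrite !belowE//; apply/andP; split; lra.
- have P : 0 <= (a - x) * (y - a) by rewrite mulr_ge0 ?subr_ge0// ltW.
  by rewrite (belowE xa) (below_eq0 (ltW ya)); apply/andP; split; lra.
- have P : 0 <= (x - a) * (a - y) by rewrite mulr_ge0 ?subr_ge0// ltW.
  by rewrite (belowE ya) (below_eq0 (ltW xa)); apply/andP; split; lra.
- by rewrite (below_eq0 (ltW xa)) (below_eq0 (ltW ya)); apply/andP; split; lra.
Qed.

Lemma continuously_differentiable_lin A (c1 c2 : R) g1 g2 :
  continuously_differentiable_on A g1 -> continuously_differentiable_on A g2 ->
  continuously_differentiable_on A (fun x => c1 * g1 x + c2 * g2 x).
Proof.
move=> [d1 [cd1 h1]] [d2 [cd2 h2]]; exists (fun x => c1 * d1 x + c2 * d2 x).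
split.
  by apply: within_continuousD; apply: within_continuousM => //;
    exact: within_continuous_cst.
move=> x Ax.
rewrite (_ : (fun y => _) = (fun y => c1 * ((g1 y - g1 x) / (y - x)) +
    c2 * ((g2 y - g2 x) / (y - x)))); last by apply/funext => y; ring.
by apply: cvgD; apply: cvgMr; [exact: h1|exact: h2].
Qed.

Lemma continuously_differentiable_below_sqr A a :
  continuously_differentiable_on A (fun x => below a x ^+ 2).
Proof.
exists (fun x => - 2 * below a x); split.
  apply: within_continuousM; first exact: within_continuous_cst.
  exact/continuous_subspaceT/below_continuous.
move=> x Ax; apply/cvgrPdist_lt => e e0.
have q : \forall y \near x, `|x - y| < e by exact: nbhsx_ballx x _ e0.
rewrite near_withinE /dnbhs near_withinE.
apply: filterS q => y xye yx _; apply: le_lt_trans xye.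
have yx0 : y - x != 0 by rewrite subr_eq0.
have nyx : 0 < `|y - x| by rewrite normr_gt0.
rewrite -(ler_pM2r nyx) -normrM [`|x - y|]distrC -normrM -expr2.
rewrite (_ : _ * (y - x) = - (below a y ^+ 2 - below a x ^+ 2 +
   2 * below a x * (y - x))); last by field.
by rewrite normrN (le_trans (below_sqr_taylor a x y))// ler_norm.
Qed.

(** Meant for u and w the values of [below a] at s <= t and d = t - s: the slope is -1 until the
    value 0 is reached, so u - w = d unless w = 0. *)
Lemma cube_diff_bounds (u w d : R) : 0 <= w -> w <= u -> u - w <= d ->
  (w == 0) || (u - w == d) ->
  3 * w ^+ 2 * d <= u ^+ 3 - w ^+ 3 <= 3 * u ^+ 2 * d.
Proof.
move=> w0 wu ud wd.
have -> : u ^+ 3 - w ^+ 3 = (u - w) * (u ^+ 2 + u * w + w ^+ 2) by ring.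
have uu : u * w <= u ^+ 2 by rewrite expr2 ler_wpM2l// (le_trans w0).
have ww : w ^+ 2 <= u * w by rewrite expr2 ler_wpM2r.
have w2 : 0 <= w ^+ 2 by rewrite sqr_ge0.
have uw : 0 <= u - w by rewrite subr_ge0.
apply/andP; split; last first.
  apply: (@le_trans _ _ ((u - w) * (3 * u ^+ 2))).
    by rewrite ler_wpM2l//; lra.
  by rewrite [leRHS]mulrC ler_wpM2r// mulr_ge0// sqr_ge0.
move: wd => /predU1P[->|/eqP <-]; last first.
  by rewrite mulrC ler_wpM2l//; lra.
by rewrite expr0n/= mulr0 mul0r mulr_ge0//; lra.
Qed.

Lemma primitive_below_sqr a : 0 < a -> a <= 1 ->
  primitive (fun x => 3 / a ^+ 3 * below a x ^+ 2) 1 = 1.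
Proof.
move=> a0 a1; pose b x := 3 / a ^+ 3 * below a x ^+ 2.
have a30 : 0 < (a ^+ 3)^-1 by rewrite invr_gt0 exprn_gt0.
have cb : bounded_measurable b.
  apply/bounded_measurable_continuous/within_continuousM.
    exact: within_continuous_cst.
  by apply: continuously_differentiable_continuous;
    exact: continuously_differentiable_below_sqr.
have mb x y : x <= y -> below a y <= below a x.
  by move=> xy; rewrite le_max2// lerD2l lerN2.
have b2 x y : x <= y -> b y <= b x.
  move=> xy; rewrite ler_wpM2l//; first by rewrite mulr_ge0// ltW.
  by rewrite lerXn2r ?nnegrE ?below_ge0// mb.
(* Minus the second term is an antiderivative of b, so D is constant; the factor 3 / a^3 makes the
   total mass 1. *)
pose D t := primitive b t + below a t ^+ 3 / a ^+ 3.
have : D 1 = D 0.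
  apply: (eq_of_small_increments (k := fun t => - b t)) => s t s0 st t1.
  have /andP[P1 P2] : b t * (t - s) <= primitive b t - primitive b s <=
      b s * (t - s).
    by apply: primitive_sub_bounds => // x /andP[sx xt]; rewrite !b2// ltW.
  have := @cube_diff_bounds (below a s) (below a t) (t - s).
  rewrite below_ge0 mb//.
  have H1 : below a s - below a t <= t - s.
    have [ta|ta] := leP t a; first by rewrite !belowE// ?(le_trans st)//; lra.
    rewrite (below_eq0 (ltW ta)) subr0 ge_max; apply/andP; split; lra.
  have H2 : (below a t == 0) || (below a s - below a t == t - s).
    have [ta|ta] := leP t a; last by rewrite (below_eq0 (ltW ta)) eqxx.
    by rewrite !belowE// ?(le_trans st)//; apply/orP; right; apply/eqP; ring.
  move=> /(_ isT isT H1 H2)/andP[/(ler_wpM2r (ltW a30)) Q1 /(ler_wpM2r (ltW a30)) Q2].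
  have e1 : b t * (t - s) = 3 * below a t ^+ 2 * (t - s) / a ^+ 3 by rewrite /b; ring.
  have e2 : b s * (t - s) = 3 * below a s ^+ 2 * (t - s) / a ^+ 3 by rewrite /b; ring.
  rewrite -e1 mulrBl in Q1; rewrite -e2 mulrBl in Q2.
  have e3 : (t - s) * (- b t - - b s) = b s * (t - s) - b t * (t - s) by ring.
  by rewrite /D e3 ler_norml; apply/andP; split; lra.
rewrite /D primitive0 (below_eq0 a1) (belowE (ltW a0)) subr0 add0r.
rewrite divff ?expf_neq0 ?gt_eqF//.
by rewrite expr0n/= mul0r addr0.
Qed.

(* Moving mass eps from [0, theta0 / 2] proportionally to the rest leaves the
   hazard rate, hence the virtual valuation, unchanged above theta0 / 2. *)
Lemma tilted_density f theta0 : user_density f theta0 ->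
  exists f' eps, [/\ 0 < eps, user_density f' theta0,
    forall t, theta0 <= t -> t <= 1 -> f' t = (1 + eps) * f t &
    forall t, theta0 <= t -> t <= 1 ->
      1 - cdf f' t = (1 + eps) * (1 - cdf f t)].
Proof.
move=> hf; have := virtual_valuation_in hf; rewrite in_itv/= => /andP[th0 th1].
(* With a strictly below [theta0], marginal revenue stays away from 0 on the compact [0, a]. *)
pose a := theta0 / 2.
have a0 : 0 < a by rewrite /a; lra.
have ath : a < theta0 by rewrite /a; lra.
have a1 : a <= 1 by lra.
pose b x := 3 / a ^+ 3 * below a x ^+ 2.
have ca : 0 < 3 / a ^+ 3 by rewrite divr_gt0// exprn_gt0.
have b0 x : 0 <= b x by rewrite mulr_ge0 ?sqr_ge0// ltW.
pose B := 3 / a ^+ 3 * a ^+ 2.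
have B0 : 0 < B by rewrite mulr_gt0// exprn_gt0.
have bB x : 0 <= x -> b x <= B.
  move=> x0; rewrite ler_wpM2l ?(ltW ca)//.
  by rewrite lerXn2r ?nnegrE ?below_ge0 ?(ltW a0)// below_le// ltW.
have bz x : a <= x -> b x = 0.
  by move=> ax; rewrite /b below_eq0// expr0n/= mulr0.
have bb : bounded_measurable b.
  apply/bounded_measurable_continuous/within_continuousM.
    exact: within_continuous_cst.
  by apply: continuously_differentiable_continuous;
    exact: continuously_differentiable_below_sqr.
have bf := bounded_measurable_density hf.
have b1 := primitive_below_sqr a0 a1.
have [c0 c001 hc0] := EVT_min ler01 (density_continuous hf).
have fc0 := density_gt0 hf c001.
have cmr : {within `[0, a], continuous (marginal_revenue (f := f))}.
  apply: continuous_subspaceW (marginal_revenue_continuous hf).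
  by apply: subset_itvl; rewrite bnd_simp.
have [c1 c1a hc1] := EVT_max (ltW a0) cmr.
have mc1 : marginal_revenue (f := f) c1 < 0.
  move: c1a; rewrite in_itv/= => /andP[c10 c1a].
  have c101 : c1 \in `[0, 1] by rewrite in_itv/= c10; lra.
  rewrite -(virtual_valuationM hf c101) nmulr_rlt0 ?(density_gt0 hf)//.
  by apply: (virtual_valuation_lt0 hf) => //; lra.
(* The first bound excludes a zero of the new virtual valuation below a; the second keeps the new
   density positive. *)
pose eps := Num.min (- marginal_revenue (f := f) c1) (f c0 / (B + 1)).
have eps0 : 0 < eps.
  by rewrite lt_min oppr_gt0 mc1 divr_gt0//; lra.
have eps1 : eps <= - marginal_revenue (f := f) c1 by rewrite ge_min lexx.
have eps2 : eps * B < f c0.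
  have : eps * (B + 1) <= f c0 by rewrite -ler_pdivlMr ?ge_min ?lexx ?orbT//; lra.
  by lra.
pose f' x := (1 + eps) * f x + (- eps) * b x.
have bef : bounded_measurable (fun x => (1 + eps) * f x).
  by apply: bounded_measurable_mul => //; exact: bounded_measurable_cst.
have beb : bounded_measurable (fun x => - eps * b x).
  by apply: bounded_measurable_mul => //; exact: bounded_measurable_cst.
have F' t : 0 <= t -> t <= 1 ->
    cdf f' t = (1 + eps) * cdf f t - eps * primitive b t.
  move=> t0 t1; rewrite -[cdf f' t]/(primitive f' t).
  rewrite (primitiveD t0 t1 bef beb) (primitiveZ _ t0 t1 bf).
  by rewrite (primitiveZ _ t0 t1 bb) mulNr.
have pb t : 0 <= t -> t <= 1 -> 0 <= primitive b t.
  move=> t0 t1; have -> : 0 = primitive (fun=> 0) t by rewrite primitive_cst// mul0r.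
  by apply: le_primitive => //; exact: bounded_measurable_cst.
have pba t : a <= t -> t <= 1 -> primitive b t = 1.
  move=> at_ t1; apply/eqP; rewrite eq_sym -subr_eq0 -b1.
  have /andP[] : 0 * (1 - t) <= primitive b 1 - primitive b t <= 0 * (1 - t).
    apply: primitive_sub_bounds => //; first lra.
    by move=> x /andP[tx _]; rewrite bz ?lexx//; lra.
  by rewrite !mul0r => P1 P2; rewrite eq_le P2 P1.
have f'a t : a <= t -> f' t = (1 + eps) * f t.
  by move=> at_; rewrite /f' bz// mulr0 addr0.
have F'a t : a <= t -> t <= 1 -> 1 - cdf f' t = (1 + eps) * (1 - cdf f t).
  by move=> at_ t1; rewrite F'//; [rewrite pba//; ring|lra].
have G't t : a <= t -> t <= 1 -> virtual_valuation f' t = virtual_valuation f t.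
  move=> at_ t1; rewrite /virtual_valuation f'a// F'a// -mulf_div divff ?mul1r//.
  by rewrite gt_eqF//; lra.
have f'0 x : x \in `[0, 1] -> 0 < f' x.
  move=> x01; have x0 : 0 <= x by rewrite (itvP x01).
  have := ler_wpM2l (ltW eps0) (bB x x0); have := hc0 x x01.
  have := mulr_gt0 eps0 (density_gt0 hf x01).
  by rewrite /f'; lra.
exists f', eps; split => //; last first.
- by move=> t tt; apply: F'a; lra.
- by move=> t tt _; apply: f'a; lra.
split => //.
- apply: continuously_differentiable_lin (density_C1 hf) _.
  (* The zero term lets the lemma on linear combinations handle a mere scaling. *)
  rewrite (_ : b = fun x => 3 / a ^+ 3 * below a x ^+ 2 + 0 * f x); last first.
    by apply/funext => x; rewrite mul0r addr0.
  apply: continuously_differentiable_lin (density_C1 hf).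
  exact: continuously_differentiable_below_sqr.
- rewrite EFin_primitive; last exact: bounded_measurable_add bef beb.
  rewrite -[primitive f' 1]/(cdf f' 1) F'// (cdf1 hf) pba//.
  by congr EFin; ring.
- exact: virtual_valuation_in hf.
- by rewrite G't ?(virtual_valuation_zero hf)//; lra.
- move=> x x01 Gx; have := x01; rewrite in_itv/= => /andP[x0 x1].
  have [ax|xa] := leP a x.
    by apply: (virtual_valuation_uniq hf x01); rewrite -G't// ltW.
  have fx0 : 0 < f' x by apply: f'0; rewrite in_itv/= !ltW.
  have : x * f' x = 1 - cdf f' x.
    by move/eqP: Gx; rewrite subr_eq0 => /eqP xE; rewrite {1}xE divfK// gt_eqF.
  have xa' : x \in `[0, a] by rewrite in_itv/= !ltW.
  have mrx := hc1 x xa'; rewrite {1}/marginal_revenue in mrx.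
  rewrite (F' _ (ltW x0) (ltW x1)) /f' => eq.
  have pbx := pb x (ltW x0) (ltW x1); have xb := mulr_ge0 (ltW x0) (b0 x).
  move: eps1 mc1 mrx; set m := marginal_revenue c1 => eps1 mc1 mrx.
  have E1 := mulr_ge0 (ltW eps0) xb; have E2 := mulr_ge0 (ltW eps0) pbx.
  (* The new marginal revenue is (1 + eps) times the old one plus eps, minus nonnegative terms; it
     is at most (1 + eps) m + eps <= eps m < 0. *)
  have E3 : (1 + eps) * (x * f x - (1 - cdf f x)) <= (1 + eps) * m.
    by rewrite ler_wpM2l//; lra.
  have E4 : eps * m < 0 by rewrite pmulr_rlt0.
  by exfalso; lra.
- move=> x y x1 y1 xy.
  have := virtual_valuation_incr hf x1 y1 xy.
  move: x1 y1; rewrite !in_itv/= => /andP[? ?] /andP[? ?].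
  by rewrite !G't//; lra.
Qed.

End Tilt.

(** Types below [that] consume nothing since w 1 = 0, and the others lie above [theta0], where the
    density is scaled by 1 + eps. So the usage scales by 1 + eps, while G is unchanged there. *)
Lemma tilted_system (R : realType) (f f' v : R -> R) (w : R -> \bar R)
    (theta0 : R) (h0 : \bar R) (h1 C eps : R) (q : R -> R) (that mu : R) :
  user_density f theta0 -> utility_function v -> capacity_function w ->
  regular_virtual_capacity v w h0 h1 -> 0 < eps ->
  (forall t, theta0 <= t -> t <= 1 -> f' t = (1 + eps) * f t) ->
  (forall t, theta0 <= t -> t <= 1 -> 1 - cdf f' t = (1 + eps) * (1 - cdf f t)) ->
  optimality_system f v w theta0 h0 h1 (C / (1 + eps)) q that mu ->
  optimality_system f' v w theta0 h0 h1 C q that mu.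
Proof.
move=> hf hv hw hh eps0 f'E F'E s.
have eps1 : 0 < 1 + eps by lra.
have GE t : theta0 <= t -> t <= 1 -> virtual_valuation f' t = virtual_valuation f t.
  move=> tt t1; rewrite /virtual_valuation f'E// F'E// -mulf_div divff ?mul1r//.
  by rewrite gt_eqF.
have /andP[tt t1] := marginal_user_itv s.
split.
- exact: shadow_price_gt0 s.
- exact: marginal_user_in s.
- by rewrite GE// (marginal_user_eq s).
- exact: choice_below s.
- move=> t ti; rewrite GE; first exact: choice_above s _ ti.
    by rewrite (le_trans tt)// (itvP ti).
  by rewrite (itvP ti).
have -> : capacity_usage f' w q = (\int[lebesgue_measure]_(t in `[0%R, 1%R])
    ((1 + eps)%:E * (w (q t) * (f t)%:E)))%E.
  apply: eq_integral => t; rewrite inE/= in_itv/= => /andP[t0 t1'].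
  have [tht|tht] := leP that t.
    by rewrite f'E ?(le_trans tt)// EFinM muleCA.
  by rewrite (choice_belowE s t0 tht) (capacity_1 hw) !mul0e mule0.
rewrite ge0_integralZl//=.
- rewrite -/(capacity_usage f w q) (capacity_binding s) -EFinM mulrC divfK//.
  by rewrite gt_eqF.
- exact: (measurable_usage hf hw (choice_in s) (choice_nonincreasing hf hh s)).
- move=> t t01; rewrite mule_ge0 ?(capacity_ge0 hw) ?(choice_in s)//.
  by rewrite lee_fin ltW// (density_gt0 hf).
- by rewrite lee_fin ltW.
Qed.

Theorem corollary3 (R : realType) (f v : R -> R) (w : R -> \bar R)
    (theta0 : R) (h0 : \bar R) (h1 : R)
    (hf : user_density f theta0) (hv : utility_function v)
    (hw : capacity_function w) (hh : regular_virtual_capacity v w h0 h1)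
    (qstar : R -> R -> R) (thetahat mu : R -> R)
    (hsol : forall C : R, 0 < C -> (C%:E < max_capacity f w theta0)%E ->
       optimality_system f v w theta0 h0 h1 C
         (qstar C) (thetahat C) (mu C)) :
  [/\ (* users below the marginal value do not use the service *)
      forall C : R, 0 < C -> (C%:E < max_capacity f w theta0)%E ->
        forall (Q : set R) (p q : R -> R), isp_optimal f v w C Q p q ->
        forall t : R, 0 <= t -> t < thetahat C -> q t = 1,
      (* (a) *)
      h1 = 0 ->
        forall C : R, 0 < C -> (C%:E < max_capacity f w theta0)%E ->
        [/\ virtual_valuation f (thetahat C) = 0,
            forall x : R, 0 <= x <= 1 -> virtual_valuation f x = 0 ->
              x = thetahat C
          & thetahat C = theta0]
    & (* (b) *)
      0 < h1 ->
        [/\ (* dependence on the user distribution *)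
            forall C : R, 0 < C -> (C%:E < max_capacity f w theta0)%E ->
              exists (f' : R -> R) (theta0' : R),
                [/\ user_density f' theta0',
                    (C%:E < max_capacity f' w theta0')%E
                  & exists (q' : R -> R) (that' mu' : R),
                      optimality_system f' v w theta0' h0 h1 C q' that' mu'
                      /\ that' <> thetahat C],
            (* dependence on, and monotonicity in, the capacity *)
            forall C1 C2 : R, 0 < C1 -> C1 < C2 ->
              (C2%:E < max_capacity f w theta0)%E ->
              thetahat C2 < thetahat C1
          & (* limit as the capacity tends to its upper bound, which may
               be infinite *)
            thetahat (fine x)
              @[x --> within [set x : \bar R | (x < max_capacity f w theta0)%E]
                        (nbhs (max_capacity f w theta0))] --> theta0]].
Proof.
have th01 := theta0_itv hf.
have cap0 := max_capacity_gt0 hf hv hw hh.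
split.
- by move=> C C0 Cm Q p q opt; apply: (optimal_below hf hv hw hh (hsol _ C0 Cm) opt).
- move=> h10 C C0 Cm; have s := hsol _ C0 Cm.
  have /andP[tt t1] := marginal_user_itv s.
  have G0 : virtual_valuation f (thetahat C) = 0.
    by rewrite (marginal_user_eq s) h10 mulr0.
  have that0 : thetahat C = theta0.
    apply: (virtual_valuation_zero_unique hf) => //.
    by rewrite in_itv/= t1 (le_trans _ tt)//; case/andP : th01 => /ltW.
  split => // x x01 Gx; rewrite that0.
  by apply: (virtual_valuation_zero_unique hf); rewrite ?in_itv.
move=> h10.
have decr (C1 C2 : R) : 0 < C1 -> C1 < C2 -> (C2%:E < max_capacity f w theta0)%E ->
    thetahat C2 < thetahat C1.
  move=> C10 C12 C2m; have C1m : (C1%:E < max_capacity f w theta0)%E.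
    by apply: le_lt_trans C2m; rewrite lee_fin ltW.
  have s1 := hsol _ C10 C1m; have s2 := hsol _ (lt_trans C10 C12) C2m.
  exact: (marginal_user_decr hf hw hh h10 s1 s2 C12).
split => //.
- move=> C C0 Cm; have [f' [eps [eps0 hf' f'E F'E]]] := tilted_density hf.
  have eps1 : 1 < 1 + eps by rewrite ltrDl.
  have eps10 : 0 < 1 + eps := lt_trans ltr01 eps1.
  have C'0 : 0 < C / (1 + eps) by rewrite divr_gt0.
  have C'C : C / (1 + eps) < C by rewrite ltr_pdivrMr// ltr_pMr.
  have C'm : ((C / (1 + eps))%:E < max_capacity f w theta0)%E.
    by apply: lt_trans Cm; rewrite lte_fin.
  exists f', theta0; split => //.
    apply: (lt_le_trans Cm); rewrite /max_capacity F'E//; last first.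
      by case/andP : th01 => _ /ltW.
    rewrite lee_wpmul2r ?(ltW (capacity0_gt0 hv hw hh))// lee_fin.
    rewrite ler_peMl ?ltW// subr_gt0 -(cdf1 hf).
    by case/andP : th01 => /ltW t0 t1; apply: (cdf_lt hf).
  exists (qstar (C / (1 + eps))), (thetahat (C / (1 + eps))), (mu (C / (1 + eps))).
  split; first exact: (tilted_system hf hv hw hh eps0 f'E F'E (hsol _ C'0 C'm)).
  by move=> e; have := decr _ _ C'0 C'C Cm; rewrite e ltxx.
apply/cvgrPdist_lt => e e0.
(* By monotonicity, one capacity whose marginal type is within e of [theta0] settles all larger
   ones. *)
have [C [C0 Cm Ce]] : exists C, [/\ 0 < C, (C%:E < max_capacity f w theta0)%E &
    thetahat C < theta0 + e].
  (* The second argument keeps a < 1 when e is large. *)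
  apply: contrapT => nC; pose a := Num.min (theta0 + e) ((theta0 + 1) / 2).
  apply: (marginal_user_close hf hv hw hh h10 (a := a)).
  - by rewrite lt_min; apply/andP; split; lra.
  - by rewrite gt_min; apply/orP; right; lra.
  move=> C C0 Cm; exists (qstar C), (thetahat C), (mu C); split; first exact: hsol.
  rewrite ge_min; apply/orP; left; rewrite leNgt; apply/negP => Ce.
  by apply: nC; exists C.
rewrite near_withinE.
have : \forall x \near max_capacity f w theta0, (C%:E < x)%E.
  by apply: open_nbhs_nbhs; split => //; exact: open_ereal_gt_ereal.
(* Infinite x drop out, -oo by C < x and +oo by x being below the maximal capacity, so [fine x] is x
   here. *)
apply: filterS => -[x| |]// Cx xm.
- rewrite /= lte_fin in Cx; have x0 := lt_trans C0 Cx.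
  have /andP[tt _] := marginal_user_itv (hsol _ x0 xm).
  have := decr _ _ C0 Cx xm.
  by rewrite /= distrC ger0_norm ?subr_ge0//; lra.
- by move: xm; rewrite /= ltNge leey.
Qed.
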